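(* Let $A$ be a ring and $\mathfrak a=(t)\subseteq A$ a principal ideal such that $A$ is $\mathfrak a$-adically complete. Let $\pi\colon B\to\bar B$ be a surjective $A$-homomorphism of formally finitely generated $A$-algebras, and let $C$ and $\bar C$ be $A$-algebras such that there is an exact sequence $0\to I\to C\xrightarrow{\varphi}\bar C\to 0$ with $\varphi$ a homomorphism of $A$-algebras, and $C$ is $\mathfrak aC$-adically complete. Suppose that $r,h,c,n$ are natural numbers such that: (1) $\mathfrak a^rC\cap\mathrm{Ann}_C(t)=0$ and $\mathfrak a^r\bar C\cap\mathrm{Ann}_{\bar C}(t)=0$; (2) $\mathfrak a^kC\cap I=\mathfrak a^{k-c}(\mathfrak a^cC\cap I)$ for all $k\geqslant c$; (3) $\mathfrak a^hB\subseteq\bar H_{B/A}$ and $\mathfrak a^h\bar B\subseteq\bar H_{\bar B/A}$; (4) $n>\max(r+2h,\,c+2h,\,4h)$. Let $\alpha_n\colon B\to C/\mathfrak a^nC$ and $\beta_n\colon\bar B\to\bar C/\mathfrak a^n\bar C$ be $A$-homomorphisms with $\varphi_n\circ\alpha_n=\beta_n\circ\pi$, where $\varphi_n\colon C/\mathfrak a^nC\to\bar C/\mathfrak a^n\bar C$ is induced by $\varphi$. Then there exist $A$-homomorphisms $\alpha\colon B\to C$ and $\beta\colon\bar B\to\bar C$ such that $\varphi\circ\alpha=\beta\circ\pi$, the composite of $\alpha$ with $C\to C/\mathfrak a^{n-2h}C$ equals the composite of $\alpha_n$ with $C/\mathfrak a^nC\to C/\mathfrak a^{n-2h}C$, and the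 composite of $\beta$ with $\bar C\to\bar C/\mathfrak a^{n-2h}\bar C$ equals the composite of $\beta_n$ with $\bar C/\mathfrak a^n\bar C\to\bar C/\mathfrak a^{n-2h}\bar C$.
   Context: All rings are commutative, unital and Noetherian (this applies to all the algebras named in the statement). Complete means complete and separated. For a finite set $x$ of indeterminates, $A\{x\}$ is the $\mathfrak a$-adic completion of $A[x]$; an $A$-algebra (with $A$ $\mathfrak a$-adically complete) is formally finitely generated if it is isomorphic to a quotient of $A\{x\}$ for some finite set $x$. For an $A$-algebra $B$ and a $B$-module $N$, an extension of $B$ by $N$ is an exact sequence $0\to N\to D\to B\to 0$ where $D$ is an $A$-algebra, $D\to B$ is a homomorphism of $A$-algebras, and its kernel $N$ is a square-zero ideal whose induced $B$-module structure is the given one. $\mathrm E_A(B,N)$ denotes the set of isomorphism classes of such extensions (isomorphisms of $A$-algebras inducing the identity on $N$ and $B$); it is a $B$-module under Baer sum, with $b\in B$ acting by pushout along multiplication by $b$ on $N$. For a formally finitely generated $A$-algebra $B$, $\bar H_{B/A}=\bigcap_{M}\mathrm{Ann}_B(\mathrm E_A(B,M))$, the intersection over all finite $B$-modules $M$. *)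

(* Defs.v *)
From HB Require Import structures.
From mathcomp Require Import all_boot all_algebra.
From mathcomp.multinomials Require Import mpoly.
From mathcomp Require Import boolp classical_sets functions cardinality.

Set Implicit Arguments.
Unset Strict Implicit.
Unset Printing Implicit Defensive.

Import GRing.Theory.
Local Open Scope quotient_scope.
Local Open Scope classical_set_scope.
Local Open Scope ring_scope.

(* Rings are [comPzRingType]s: the zero ring is allowed. *)

Definition surjective (X Y : Type) (f : X -> Y) : Prop :=
  forall y, exists x, f x = y.

Record ideal (R : comPzRingType) := Ideal {
  ideal_set :> set R;
  ideal0 : ideal_set 0;
  idealD : forall x y, ideal_set x -> ideal_set y -> ideal_set (x + y);
  idealMl : forall r x, ideal_set x -> ideal_set (r * x) }.

(* Second coercion: [ideal_set] lands in [set R], which is not a Funclass. *)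
Definition ideal_mem (R : comPzRingType) (I : ideal R) : R -> Prop := ideal_set I.
Coercion ideal_mem : ideal >-> Funclass.
Arguments ideal_mem /.

Definition ann (R : comPzRingType) (x : R) : set R := [set y | x * y = 0].

Section IdealOps.
Variable R : comPzRingType.
Implicit Types (I J : ideal R) (S : set R) (x y r : R).

Lemma idealN I x : I x -> I (- x).
Proof. by rewrite -mulN1r; exact: idealMl. Qed.

Lemma idealMr I x r : I x -> I (x * r).
Proof. by rewrite mulrC; exact: idealMl. Qed.

Definition gen_set S : set R :=
  [set x | exists2 s : seq (R * R),
     forall p, p \in s -> S p.2 & x = \sum_(p <- s) p.1 * p.2].

Fact gen_set0 S : gen_set S 0.
Proof. by exists [::]; rewrite ?big_nil. Qed.

Fact gen_setD S x y : gen_set S x -> gen_set S y -> gen_set S (x + y).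
Proof.
move=> [s sS ->] [s' sS' ->]; exists (s ++ s'); last by rewrite big_cat.
by move=> p; rewrite mem_cat => /orP[/sS|/sS'].
Qed.

Fact gen_setMl S r x : gen_set S x -> gen_set S (r * x).
Proof.
move=> [s sS ->]; exists [seq (r * p.1, p.2) | p <- s].
  by move=> _ /mapP[p ps ->]; exact: sS ps.
by rewrite big_map mulr_sumr; apply: eq_bigr => p _; rewrite mulrA.
Qed.

Definition ideal_gen S : ideal R :=
  Ideal (gen_set0 S) (@gen_setD S) (@gen_setMl S).

Lemma sub_gen S x : S x -> ideal_gen S x.
Proof.
move=> Sx; exists [:: (1, x)]; last by rewrite big_seq1 mul1r.
by move=> p; rewrite inE => /eqP ->.
Qed.

Lemma gen_sub S I : S `<=` I -> ideal_gen S `<=` I.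
Proof.
move=> SI _ [s sS ->]; rewrite big_seq.
apply: (big_ind (fun z => I z)); [exact: ideal0|exact: idealD|].
by move=> p /sS /SI; exact: idealMl.
Qed.

Definition ideal_full : ideal R :=
  @Ideal R setT I (fun _ _ _ _ => I) (fun _ _ _ => I).

Definition ideal_cap I J : ideal R :=
  @Ideal R (I `&` J) (conj (ideal0 I) (ideal0 J))
    (fun x y '(conj Ix Jx) '(conj Iy Jy) => conj (idealD Ix Iy) (idealD Jx Jy))
    (fun r x '(conj Ix Jx) => conj (idealMl r Ix) (idealMl r Jx)).

Definition ideal_mul I J : ideal R :=
  ideal_gen [set x | exists i j, [/\ I i, J j & x = i * j]].

Definition ideal_exp I (k : nat) : ideal R := iter k (ideal_mul I) ideal_full.

Lemma ideal_exp_le I m n : (m <= n)%N -> ideal_exp I n `<=` ideal_exp I m.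
Proof.
move=> /subnK <-; elim: (n - m)%N => [//|d IHd] x.
rewrite addSn => Ix; apply: IHd; move: x Ix; apply: gen_sub.
by move=> _ [i [j [_ Jj ->]]]; exact: idealMl.
Qed.

Definition noetherian : Prop :=
  forall I, exists2 S, finite_set S & I = ideal_gen S :> set R.

End IdealOps.

Section Quotient.
Variables (R : comPzRingType) (I : ideal R).

Definition quot_rel (x y : R) : bool := `[< I (x - y) >].

Fact quot_rel_equiv : equiv_class_of quot_rel.
Proof.
split=> [x|x y|y x z].
- by apply/asboolP; rewrite subrr; exact: ideal0.
- by apply/asboolP/asboolP => /idealN; rewrite opprB.
- move=> /asboolP Ixy /asboolP Iyz; apply/asboolP.
  by rewrite -(subrKA y); exact: idealD.
Qed.

Canonical quot_equiv : equiv_rel R := EquivRelPack quot_rel_equiv.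

Definition quot : Type := {eq_quot quot_equiv}.
HB.instance Definition _ := Choice.on quot.
HB.instance Definition _ := EqQuotient.on quot.

Definition quot_pi (x : R) : quot := \pi_quot x.

Lemma quot_piP x y : quot_pi x = quot_pi y <-> I (x - y).
Proof.
split=> [/eqP|Ixy]; first by rewrite /quot_pi eqmodE => /asboolP.
by apply/eqP; rewrite /quot_pi eqmodE; apply/asboolP.
Qed.

Lemma quot_reprK q : quot_pi (repr q) = q.
Proof. exact: reprK. Qed.

Lemma quot_piW (P : quot -> Prop) : (forall x, P (quot_pi x)) -> forall q, P q.
Proof. by move=> H q; rewrite -(quot_reprK q). Qed.

Lemma repr_quot_pi x : I (repr (quot_pi x) - x).
Proof. by apply/quot_piP; rewrite quot_reprK. Qed.

Definition quot_add (p q : quot) : quot := quot_pi (repr p + repr q).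
Definition quot_opp (p : quot) : quot := quot_pi (- repr p).
Definition quot_mul (p q : quot) : quot := quot_pi (repr p * repr q).

Lemma quot_addE x y : quot_add (quot_pi x) (quot_pi y) = quot_pi (x + y).
Proof.
by apply/quot_piP; rewrite opprD addrACA; apply: idealD; exact: repr_quot_pi.
Qed.

Lemma quot_oppE x : quot_opp (quot_pi x) = quot_pi (- x).
Proof.
by apply/quot_piP; rewrite -opprD; apply: idealN; exact: repr_quot_pi.
Qed.

Lemma quot_mulE x y : quot_mul (quot_pi x) (quot_pi y) = quot_pi (x * y).
Proof.
apply/quot_piP; set u := repr _; set v := repr _.
rewrite (_ : _ - _ = (u - x) * v + x * (v - y)); last first.
  by rewrite mulrBl mulrBr addrA subrK.
by apply: idealD; [apply: idealMr|apply: idealMl]; exact: repr_quot_pi.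
Qed.

Fact quot_addA : associative quot_add.
Proof.
by do 3![elim/quot_piW=> ?]; rewrite !quot_addE addrA.
Qed.
Fact quot_addC : commutative quot_add.
Proof. by do 2![elim/quot_piW=> ?]; rewrite !quot_addE addrC. Qed.
Fact quot_add0 : left_id (quot_pi 0) quot_add.
Proof. by elim/quot_piW=> ?; rewrite quot_addE add0r. Qed.
Fact quot_addN : left_inverse (quot_pi 0) quot_opp quot_add.
Proof. by elim/quot_piW=> ?; rewrite quot_oppE quot_addE addNr. Qed.

HB.instance Definition _ :=
  GRing.isZmodule.Build quot quot_addA quot_addC quot_add0 quot_addN.

Fact quot_mulA : associative quot_mul.
Proof. by do 3![elim/quot_piW=> ?]; rewrite !quot_mulE mulrA. Qed.
Fact quot_mulC : commutative quot_mul.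
Proof. by do 2![elim/quot_piW=> ?]; rewrite !quot_mulE mulrC. Qed.
Fact quot_mul1 : left_id (quot_pi 1) quot_mul.
Proof. by elim/quot_piW=> ?; rewrite quot_mulE mul1r. Qed.
Fact quot_mulDl : left_distributive quot_mul +%R.
Proof.
do 3![elim/quot_piW=> ?].
by rewrite /+%R /= !(quot_addE, quot_mulE) mulrDl.
Qed.

HB.instance Definition _ :=
  GRing.Zmodule_isComPzRing.Build quot quot_mulA quot_mulC quot_mul1 quot_mulDl.

Fact quot_pi_is_zmod : zmod_morphism quot_pi.
Proof.
by move=> x y; rewrite /GRing.opp /GRing.add /= quot_oppE quot_addE.
Qed.
Fact quot_pi_is_monoid : monoid_morphism quot_pi.
Proof. by split=> // x y; rewrite /GRing.mul /= quot_mulE. Qed.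

HB.instance Definition _ := GRing.isZmodMorphism.Build R quot quot_pi quot_pi_is_zmod.
HB.instance Definition _ := GRing.isMonoidMorphism.Build R quot quot_pi quot_pi_is_monoid.

Section Lift.
Variables (S : comPzRingType) (f : {rmorphism R -> S}).
Hypothesis fI : forall x, I x -> f x = 0.

Definition quot_lift of (forall x, I x -> f x = 0) := fun q : quot => f (repr q).

Lemma quot_liftE x : quot_lift fI (quot_pi x) = f x.
Proof. by apply/subr0_eq; rewrite -rmorphB; apply/fI/repr_quot_pi. Qed.

Fact quot_lift_is_zmod : zmod_morphism (quot_lift fI).
Proof.
by do 2![elim/quot_piW=> ?]; rewrite -rmorphB !quot_liftE rmorphB.
Qed.
Fact quot_lift_is_monoid : monoid_morphism (quot_lift fI).
Proof.
split=> [|]; first by rewrite -(rmorph1 quot_pi) quot_liftE rmorph1.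
by do 2![elim/quot_piW=> ?]; rewrite -rmorphM !quot_liftE rmorphM.
Qed.

HB.instance Definition _ :=
  GRing.isZmodMorphism.Build quot S (quot_lift fI) quot_lift_is_zmod.
HB.instance Definition _ :=
  GRing.isMonoidMorphism.Build quot S (quot_lift fI) quot_lift_is_monoid.

End Lift.
End Quotient.

(* The library's [algType] excludes the zero ring, hence structure maps. *)
Record alg (A : comPzRingType) := Alg {
  alg_ring :> comPzRingType;
  alg_map : {rmorphism A -> alg_ring} }.

Record alg_hom (A : comPzRingType) (B C : alg A) := AlgHom {
  hom_fun :> {rmorphism B -> C};
  hom_alg : forall a, hom_fun (alg_map B a) = alg_map C a }.

Definition alg_iso (A : comPzRingType) (B C : alg A) : Prop :=
  exists f : alg_hom B C, bijective f.

Section AlgebraOps.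
Variable A : comPzRingType.
Implicit Types (B C : alg A) (a : ideal A).

Definition ideal_ext B a : ideal B := ideal_gen (alg_map B @` a).

Definition quot_alg B (I : ideal B) : alg A :=
  @Alg A (quot I) (quot_pi I \o alg_map B).

Definition quot_proj B (I : ideal B) : alg_hom B (quot_alg I) :=
  @AlgHom A B (quot_alg I) (quot_pi I) (fun=> erefl).

Section QuotHom.
Variables (B C : alg A) (f : alg_hom B C) (I : ideal B) (J : ideal C).
Hypothesis fIJ : I `<=` f @^-1` J.

Fact quot_hom_kernel x : I x -> (quot_pi J \o f) x = 0.
Proof.
move=> Ix; rewrite -(rmorph0 (quot_pi J)); apply/quot_piP.
by rewrite subr0; exact: fIJ.
Qed.

Fact quot_hom_alg b :
  quot_lift quot_hom_kernel (alg_map (quot_alg I) b) = alg_map (quot_alg J) b.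
Proof. by rewrite quot_liftE /= hom_alg. Qed.

Definition quot_hom : alg_hom (quot_alg I) (quot_alg J) :=
  @AlgHom A (quot_alg I) (quot_alg J) (quot_lift quot_hom_kernel) quot_hom_alg.

Lemma quot_homE x : quot_hom (quot_proj I x) = quot_proj J (f x).
Proof. exact: quot_liftE. Qed.

End QuotHom.

Definition alg_id B : alg_hom B B := @AlgHom A B B idfun (fun=> erefl).

Definition red B a n : alg A := quot_alg (ideal_ext B (ideal_exp a n)).

Definition red_proj B a n : alg_hom B (red B a n) := quot_proj _.

Fact ideal_ext_hom B C (f : alg_hom B C) a :
  ideal_ext B a `<=` f @^-1` ideal_ext C a.
Proof.
move=> _ [s sS ->]; rewrite /preimage /= rmorph_sum big_seq /=.
apply: (big_ind (fun z => ideal_ext C a z)); [exact: ideal0|exact: idealD|].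
move=> p /sS[x ax <-]; rewrite rmorphM hom_alg.
by apply/idealMl/sub_gen; exists x.
Qed.

Definition red_hom B C (f : alg_hom B C) a n : alg_hom (red B a n) (red C a n) :=
  quot_hom (ideal_ext_hom f (a := ideal_exp a n)).

Fact ideal_ext_exp_le B a m n : (m <= n)%N ->
  ideal_ext B (ideal_exp a n) `<=` alg_id B @^-1` ideal_ext B (ideal_exp a m).
Proof.
move=> le_mn; apply: gen_sub => _ [x ax <-]; apply: sub_gen; exists x => //.
exact: ideal_exp_le ax.
Qed.

Definition red_le B a m n (le_mn : (m <= n)%N) : alg_hom (red B a n) (red B a m) :=
  quot_hom (ideal_ext_exp_le (B := B) (a := a) le_mn).

End AlgebraOps.

(* The completion of R at J: the limit of the R / J^k. *)
Section Completion.
Variables (R : comPzRingType) (J : ideal R).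

Let Rk k := quot (ideal_exp J k).

Fact transition_kernel k x :
  ideal_exp J k.+1 x -> quot_pi (ideal_exp J k) x = 0.
Proof.
move=> /(ideal_exp_le (leqnSn k)) Jx.
by rewrite -(rmorph0 (quot_pi _)); apply/quot_piP; rewrite subr0.
Qed.

Definition transition k : {rmorphism Rk k.+1 -> Rk k} :=
  quot_lift (@transition_kernel k).

Record completion := Completion {
  comp_seq : forall k, Rk k;
  compP : forall k, transition k (comp_seq k.+1) = comp_seq k }.

Lemma completion_inj x y : (forall k, comp_seq x k = comp_seq y k) -> x = y.
Proof.
case: x y => [x xP] [y yP] /= xy.
have exy : x = y by exact: functional_extensionality_dep.
by subst y; congr Completion; exact: Prop_irrelevance.
Qed.

HB.instance Definition _ := gen_eqMixin completion.
HB.instance Definition _ := gen_choiceMixin completion.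

Fact comp0P k : transition k 0 = 0. Proof. exact: rmorph0. Qed.
Fact comp1P k : transition k 1 = 1. Proof. exact: rmorph1. Qed.
Fact comp_oppP x k : transition k (- comp_seq x k.+1) = - comp_seq x k.
Proof. by rewrite rmorphN compP. Qed.
Fact comp_addP x y k :
  transition k (comp_seq x k.+1 + comp_seq y k.+1) = comp_seq x k + comp_seq y k.
Proof. by rewrite rmorphD !compP. Qed.
Fact comp_mulP x y k :
  transition k (comp_seq x k.+1 * comp_seq y k.+1) = comp_seq x k * comp_seq y k.
Proof. by rewrite rmorphM !compP. Qed.

Definition comp0 := @Completion (fun=> 0) comp0P.
Definition comp1 := @Completion (fun=> 1) comp1P.
Definition comp_opp x := @Completion (fun k => - comp_seq x k) (comp_oppP x).
Definition comp_add x y :=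
  @Completion (fun k => comp_seq x k + comp_seq y k) (comp_addP x y).
Definition comp_mul x y :=
  @Completion (fun k => comp_seq x k * comp_seq y k) (comp_mulP x y).

Fact comp_addA : associative comp_add.
Proof. by move=> x y z; apply: completion_inj => k; exact: addrA. Qed.
Fact comp_addC : commutative comp_add.
Proof. by move=> x y; apply: completion_inj => k; exact: addrC. Qed.
Fact comp_add0 : left_id comp0 comp_add.
Proof. by move=> x; apply: completion_inj => k; exact: add0r. Qed.
Fact comp_addN : left_inverse comp0 comp_opp comp_add.
Proof. by move=> x; apply: completion_inj => k; exact: addNr. Qed.
HB.instance Definition _ :=
  GRing.isZmodule.Build completion comp_addA comp_addC comp_add0 comp_addN.

Fact comp_mulA : associative comp_mul.
Proof. by move=> x y z; apply: completion_inj => k; exact: mulrA. Qed.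
Fact comp_mulC : commutative comp_mul.
Proof. by move=> x y; apply: completion_inj => k; exact: mulrC. Qed.
Fact comp_mul1 : left_id comp1 comp_mul.
Proof. by move=> x; apply: completion_inj => k; exact: mul1r. Qed.
Fact comp_mulDl : left_distributive comp_mul +%R.
Proof. by move=> x y z; apply: completion_inj => k; exact: mulrDl. Qed.
HB.instance Definition _ := GRing.Zmodule_isComPzRing.Build completion
  comp_mulA comp_mulC comp_mul1 comp_mulDl.

Fact to_completionP x k :
  transition k (quot_pi (ideal_exp J k.+1) x) = quot_pi (ideal_exp J k) x.
Proof. exact: quot_liftE. Qed.

Definition to_completion (x : R) :=
  @Completion (fun k => quot_pi (ideal_exp J k) x) (to_completionP x).

Fact to_completion_is_zmod : zmod_morphism to_completion.
Proof. by move=> x y; apply: completion_inj => k; exact: rmorphB. Qed.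
Fact to_completion_is_monoid : monoid_morphism to_completion.
Proof. by split=> [|x y]; apply: completion_inj => k //; exact: rmorphM. Qed.
HB.instance Definition _ := GRing.isZmodMorphism.Build R completion
  to_completion to_completion_is_zmod.
HB.instance Definition _ := GRing.isMonoidMorphism.Build R completion
  to_completion to_completion_is_monoid.

Definition adic_complete : Prop := bijective to_completion.

End Completion.

Definition completion_alg (A : comPzRingType) (B : alg A) (J : ideal B) : alg A :=
  @Alg A (completion J) (to_completion J \o alg_map B).

(* [mpoly] asks for 1 != 0; over the zero ring all polynomial rings are zero. *)
Definition nontrivial (A : comPzRingType) (A1 : (1 : A) != 0) : comNzRingType :=
  HB.pack_for comNzRingType (A : Type) A
    (GRing.PzSemiRing_isNonZero.Build (A : Type) A1).

Definition poly_alg (A : comPzRingType) (m : nat) : alg A :=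
  match boolP ((1 : A) != 0) with
  | AltTrue A1 =>
    let A' := nontrivial A1 in
    @Alg A {mpoly A'[m]} (@mpolyC m A' : {rmorphism A' -> {mpoly A'[m]}})
  | AltFalse _ => @Alg A A idfun
  end.

Definition restricted_alg (A : comPzRingType) (a : ideal A) (m : nat) : alg A :=
  completion_alg (ideal_ext (poly_alg A m) a).

Definition formally_fg (A : comPzRingType) (a : ideal A) (B : alg A) : Prop :=
  exists m (K : ideal (restricted_alg a m)), alg_iso (quot_alg K) B.

(* The ring D (+) N with N^2 = 0, where D acts on the B-module N through p. *)
Section SquareZero.
Variables (D B : comPzRingType) (p : {rmorphism D -> B}) (N : lmodType B).

Definition sqz of {rmorphism D -> B} : Type := (D * N)%type.
Local Notation T := (sqz p).
HB.instance Definition _ := GRing.Zmodule.copy T (D * N)%type.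

Lemma sqz_eq (x y : T) : x.1 = y.1 -> x.2 = y.2 -> x = y.
Proof. by move: x y => [a u] [b v] /= -> ->. Qed.

Definition sqz_mul (x y : T) : T := (x.1 * y.1, p x.1 *: y.2 + p y.1 *: x.2).

Fact sqz_mulA : associative sqz_mul.
Proof.
move=> x y z; apply: sqz_eq => /=; first exact: mulrA.
rewrite !rmorphM !scalerDr !scalerA addrA (mulrC (p z.1) (p x.1)).
by rewrite (mulrC (p z.1) (p y.1)).
Qed.
Fact sqz_mulC : commutative sqz_mul.
Proof. by move=> x y; apply: sqz_eq => /=; [exact: mulrC|exact: addrC]. Qed.
Fact sqz_mul1 : left_id ((1, 0) : T) sqz_mul.
Proof.
move=> x; apply: sqz_eq => /=; first exact: mul1r.
by rewrite rmorph1 scale1r scaler0 addr0.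
Qed.
Fact sqz_mulDl : left_distributive sqz_mul +%R.
Proof.
move=> x y z; apply: sqz_eq => /=; first exact: mulrDl.
by rewrite rmorphD scalerDl scalerDr addrACA.
Qed.
HB.instance Definition _ :=
  GRing.Zmodule_isComPzRing.Build T sqz_mulA sqz_mulC sqz_mul1 sqz_mulDl.

Definition sqz_inl (d : D) : T := (d, 0).
Fact sqz_inl_is_zmod : zmod_morphism sqz_inl.
Proof. by move=> d d'; apply: sqz_eq => //=; rewrite subr0. Qed.
Fact sqz_inl_is_monoid : monoid_morphism sqz_inl.
Proof. by split=> // d d'; apply: sqz_eq => //=; rewrite !scaler0 addr0. Qed.
HB.instance Definition _ := GRing.isZmodMorphism.Build D T sqz_inl sqz_inl_is_zmod.
HB.instance Definition _ := GRing.isMonoidMorphism.Build D T sqz_inl sqz_inl_is_monoid.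

Definition sqz_inr (u : N) : T := (0, u).
Fact sqz_inr_is_zmod : zmod_morphism sqz_inr.
Proof. by move=> u v; apply: sqz_eq => //=; rewrite subr0. Qed.
HB.instance Definition _ := GRing.isZmodMorphism.Build N T sqz_inr sqz_inr_is_zmod.

Definition sqz_proj (x : T) : B := p x.1.
Fact sqz_proj_is_zmod : zmod_morphism sqz_proj.
Proof. by move=> x y; exact: rmorphB. Qed.
Fact sqz_proj_is_monoid : monoid_morphism sqz_proj.
Proof. by split=> [|x y]; [exact: rmorph1|exact: rmorphM]. Qed.
HB.instance Definition _ := GRing.isZmodMorphism.Build T B sqz_proj sqz_proj_is_zmod.
HB.instance Definition _ := GRing.isMonoidMorphism.Build T B sqz_proj sqz_proj_is_monoid.

End SquareZero.

Record extension (A : comPzRingType) (B : alg A) (N : lmodType B) := Extension {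
  ext_alg :> alg A;
  ext_inj : {additive N -> ext_alg};
  ext_proj : alg_hom ext_alg B;
  ext_injI : injective ext_inj;
  ext_projS : surjective ext_proj;
  ext_exact : forall d, ext_proj d = 0 <-> exists u, ext_inj u = d;
  ext_sqr0 : forall u v, ext_inj u * ext_inj v = 0;
  ext_modE : forall d u, d * ext_inj u = ext_inj (ext_proj d *: u) }.

Section ExtensionOps.
Variables (A : comPzRingType) (B : alg A).
Implicit Types N : lmodType B.

Definition ext_iso N (E F : extension N) : Prop :=
  exists f : alg_hom E F,
    [/\ bijective f, forall u, f (ext_inj E u) = ext_inj F u &
        forall d, ext_proj F (f d) = ext_proj E d].

Section Trivial.
Variable N : lmodType B.
Let idB : {rmorphism B -> B} := idfun.

Definition triv_alg : alg A := @Alg A (sqz N idB) (sqz_inl idB N \o alg_map B).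

Definition triv_proj : alg_hom triv_alg B :=
  @AlgHom A triv_alg B (@sqz_proj B B idB N) (fun=> erefl).

Definition triv_inj : {additive N -> triv_alg} := @sqz_inr B B idB N.

Fact triv_injI : injective triv_inj.
Proof. by move=> u v []. Qed.
Fact triv_projS : surjective triv_proj.
Proof. by move=> b; exists (b, 0). Qed.
Fact triv_exact (d : triv_alg) :
  triv_proj d = 0 <-> exists u, triv_inj u = d.
Proof.
case: d => b u; split; first by rewrite /= /sqz_proj /= => ->; exists u.
by case=> v [<- _].
Qed.
Fact triv_sqr0 (u v : N) : triv_inj u * triv_inj v = 0.
Proof. by apply: sqz_eq => /=; [exact: mul0r|rewrite !scale0r addr0]. Qed.
Fact triv_modE (d : triv_alg) (u : N) :
  d * triv_inj u = triv_inj (triv_proj d *: u).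
Proof. by apply: sqz_eq => /=; [exact: mulr0|rewrite scale0r addr0]. Qed.

Definition ext_trivial : extension N :=
  @Extension A B N triv_alg triv_inj triv_proj
    triv_injI triv_projS triv_exact triv_sqr0 triv_modE.
End Trivial.

(* Pushout of E along g: the quotient of E (+) N' by {(u, - g u) | u in N}. *)
Section Pushout.
Variables (N N' : lmodType B) (g : {linear N -> N'}) (E : extension N).
Let p : {rmorphism E -> B} := ext_proj E.
Let S : comPzRingType := sqz N' p.

Lemma ext_proj_inj u : p (ext_inj E u) = 0.
Proof. by apply/ext_exact; exists u. Qed.

Definition push_set : set S := [set x | exists u, x = (ext_inj E u, - g u)].
Fact push_set0 : push_set 0.
Proof. by exists 0; apply: sqz_eq; rewrite /= ?raddf0 ?oppr0. Qed.
Fact push_setD x y : push_set x -> push_set y -> push_set (x + y).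
Proof. by move=> [u ->] [v ->]; exists (u + v); apply: sqz_eq; rewrite /= ?raddfD ?opprD. Qed.
Fact push_setMl r x : push_set x -> push_set (r * x).
Proof.
move=> [u ->]; exists (p r.1 *: u); rewrite -ext_modE linearZ.
apply: sqz_eq => //=.
by rewrite ext_proj_inj scale0r addr0 scalerN.
Qed.
Definition push_ideal : ideal S := Ideal push_set0 push_setD push_setMl.

Definition push_alg : alg A :=
  @Alg A (quot push_ideal) (quot_pi push_ideal \o (sqz_inl p N' \o alg_map E)).

Definition push_inj : {additive N' -> push_alg} :=
  quot_pi push_ideal \o @sqz_inr E B p N'.

Fact push_kernel (x : S) : push_ideal x -> sqz_proj x = 0.
Proof. by move=> [u ->]; exact: ext_proj_inj. Qed.

Fact push_proj_alg a : quot_lift push_kernel (alg_map push_alg a) = alg_map B a.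
Proof. by rewrite quot_liftE; exact: (hom_alg (ext_proj E)). Qed.

Definition push_proj : alg_hom push_alg B :=
  @AlgHom A push_alg B (quot_lift push_kernel) push_proj_alg.

Lemma push_projE (x : S) : push_proj (quot_pi push_ideal x) = p x.1.
Proof. exact: quot_liftE. Qed.

Fact push_injI : injective push_inj.
Proof.
move=> v w /quot_piP [u [/esym/eqP]].
rewrite subr0 => /eqP u0; have {}u0 : u = 0.
  by apply: (@ext_injI _ _ _ E); rewrite u0 raddf0.
by rewrite u0 raddf0 oppr0 => /subr0_eq.
Qed.
Fact push_projS : surjective push_proj.
Proof.
move=> b; have [d <-] := ext_projS E b.
by exists (quot_pi push_ideal (d, 0)); rewrite push_projE.
Qed.
Fact push_exact d : push_proj d = 0 <-> exists u, push_inj u = d.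
Proof.
elim/quot_piW: d => -[d v]; rewrite push_projE /=; split.
  move=> /(ext_exact (e := E))[u <-]; exists (v + g u); apply/quot_piP.
  exists (- u); apply: sqz_eq; rewrite /= ?raddfN /= ?sub0r //.
  by rewrite opprK addrAC subrr add0r.
move=> [w /quot_piP [u [+ _]]]; rewrite sub0r => /eqP.
by rewrite eqr_oppLR => /eqP ->; rewrite rmorphN ext_proj_inj oppr0.
Qed.
Fact push_sqr0 u v : push_inj u * push_inj v = 0.
Proof.
rewrite /push_inj /= -rmorphM -(rmorph0 (quot_pi push_ideal)).
congr quot_pi; apply: sqz_eq => /=; first exact: mul0r.
by rewrite rmorph0 !scale0r addr0.
Qed.
Fact push_modE d u : d * push_inj u = push_inj (push_proj d *: u).
Proof.
elim/quot_piW: d => d; rewrite push_projE /= -rmorphM.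
congr quot_pi; apply: sqz_eq => /=; first exact: mulr0.
by rewrite rmorph0 scale0r addr0.
Qed.

Definition ext_pushout : extension N' :=
  @Extension A B N' push_alg push_inj push_proj
    push_injI push_projS push_exact push_sqr0 push_modE.
End Pushout.

Definition ext_scale N (b : B) (E : extension N) : extension N :=
  ext_pushout ( *:%R b : {linear N -> N}) E.

Section ZeroClass.
Variables (N : lmodType B) (E : extension N).
Let p : {rmorphism E -> B} := ext_proj E.

Definition zero_map (x : sqz N p) : ext_trivial N := (p x.1, x.2).

Fact zero_map_is_zmod : zmod_morphism zero_map.
Proof. by move=> x y; apply: sqz_eq => //=; exact: rmorphB. Qed.
Fact zero_map_is_monoid : monoid_morphism zero_map.
Proof.
by split=> [|x y]; apply: sqz_eq => //=; [exact: rmorph1|exact: rmorphM].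
Qed.
HB.instance Definition _ := GRing.isZmodMorphism.Build
  (sqz N p) (ext_trivial N) zero_map zero_map_is_zmod.
HB.instance Definition _ := GRing.isMonoidMorphism.Build
  (sqz N p) (ext_trivial N) zero_map zero_map_is_monoid.

Let g0 : {linear N -> N} := *:%R (0 : B).

Fact zero_map_kernel x : push_ideal g0 E x -> zero_map x = 0.
Proof.
move=> [u ->]; apply: sqz_eq => /=; first exact: ext_proj_inj.
by rewrite scale0r oppr0.
Qed.

Fact zero_hom_alg a :
  quot_lift zero_map_kernel (alg_map (ext_scale 0 E) a) = alg_map (ext_trivial N) a.
Proof.
rewrite quot_liftE; apply: sqz_eq => //=; exact: (hom_alg (ext_proj E)).
Qed.

Definition zero_hom : alg_hom (ext_scale 0 E) (ext_trivial N) :=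
  @AlgHom A (ext_scale 0 E) (ext_trivial N) (quot_lift zero_map_kernel) zero_hom_alg.

Lemma ext_scale0 : ext_iso (ext_scale 0 E) (ext_trivial N).
Proof.
have homE x : zero_hom (quot_pi _ x) = zero_map x := quot_liftE zero_map_kernel x.
have inj : injective zero_hom.
  elim/quot_piW => x; elim/quot_piW => y; rewrite !homE => -[/eqP].
  rewrite -subr_eq0 -rmorphB => /eqP /(ext_exact (e := E)) [u eu] exy.
  apply/quot_piP; exists u; apply: sqz_eq; rewrite /= ?eu //.
  by rewrite scale0r oppr0 exy subrr.
have surj y : {x | zero_hom x = y}.
  apply: cid; case: y => b u; have [d <-] := ext_projS E b.
  by exists (quot_pi _ ((d, u) : sqz N p)); rewrite homE.
exists zero_hom; split.
- exists (fun y => sval (surj y)) => x; last by case: surj.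
  by apply: inj; case: surj.
- by move=> u; rewrite homE; apply: sqz_eq => //=; exact: rmorph0.
- by elim/quot_piW => x; rewrite homE push_projE.
Qed.

End ZeroClass.

(* As 0 . E is trivial, the class of the trivial extension is the zero of
   E_A(B, N). *)
Definition ann_ext N : set B :=
  [set b | forall E : extension N, ext_iso (ext_scale b E) (ext_trivial N)].

Definition finite_module N : Prop :=
  exists m (g : 'I_m -> N), forall x, exists c : 'I_m -> B, x = \sum_i c i *: g i.

Definition Hbar : set B :=
  [set b | forall M : lmodType B, finite_module M -> ann_ext M b].

End ExtensionOps.

Arguments Hbar {A} B.

(* Main.v *)
Require Import Defs.
From HB Require Import structures.
From mathcomp Require Import all_boot all_algebra.
From mathcomp Require Import boolp classical_sets.
From mathcomp Require Import cardinality.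
From mathcomp.multinomials Require Import mpoly.
From mathcomp Require Import ring zify.
(* Again, because [ring_quotient] also has an [idealMr]. *)
Require Import Defs.

Set Implicit Arguments.
Unset Strict Implicit.
Unset Printing Implicit Defensive.

Import GRing.Theory.
Local Open Scope classical_set_scope.
Local Open Scope ring_scope.

(* Present B as P / K with P = A{x}; then P is Noetherian, so K / K^2 is a
   finite B-module, and the vanishing of t^h times the class of P / K^2 in
   E_A(B, K / K^2) provides a derivation D : P -> K / K^2 over A that restricts
   to t^h on K.

   Let J be a closed ideal of C and J_k = t^k C /\ J.  If f : P -> C maps K into
   J_m, then t^(-h) (f o D) makes sense modulo J_(2m-h), since multiplication by
   t^h is a bijection J_(m-h) -> J_m (Artin-Rees and the torsion bound).  The
   difference f - t^(-h) (f o D) is multiplicative modulo J_(2m-2h) and maps K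
   into J_(2m-2h).  As 2m - 2h > m, iterating converges to a homomorphism that
   kills K and is congruent to f modulo J_(m-h).

   This is applied first to bar B, bar C with J = bar C and m = n, which gives
   beta; then to B, C with J = I and m = n - h, starting from a map P -> C that
   lifts both alpha_n modulo t^(n-h) and beta o pi. *)

(** * Principal ideals and completeness with respect to the powers of one element *)

Section PrincipalIdeals.
Variable R : comPzRingType.
Implicit Types (s t x y : R) (J : ideal R).

Fact pideal0 s : [set x | exists y, x = s * y] 0.
Proof. by exists 0; rewrite mulr0. Qed.
Fact pidealD s x y : [set x | exists y, x = s * y] x ->
  [set x | exists y, x = s * y] y -> [set x | exists y, x = s * y] (x + y).
Proof. by move=> [u ->] [v ->]; exists (u + v); rewrite mulrDr. Qed.
Fact pidealMl s r x : [set x | exists y, x = s * y] x ->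
  [set x | exists y, x = s * y] (r * x).
Proof. by move=> [u ->]; exists (r * u); rewrite mulrCA. Qed.

Definition pideal s : ideal R := Ideal (pideal0 s) (@pidealD s) (@pidealMl s).

Lemma ideal_eq J x y : J x -> x = y -> J y.
Proof. by move=> Jx <-. Qed.

Lemma idealB J x y : J x -> J y -> J (x - y).
Proof. by move=> Jx Jy; apply: idealD => //; exact: idealN. Qed.

Lemma ideal_sum (T : Type) (r : seq T) (P : pred T) (F : T -> R) J :
  (forall i, P i -> J (F i)) -> J (\sum_(i <- r | P i) F i).
Proof.
move=> JF; apply: (big_ind (fun x => J x)) => //; first exact: ideal0.
by move=> x y; exact: idealD.
Qed.

Lemma pideal_exp_le t m n x :
  (m <= n)%N -> pideal (t ^+ n) x -> pideal (t ^+ m) x.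
Proof.
move=> /subnKC <- [y ->]; exists (t ^+ (n - m) * y).
by rewrite mulrA exprD.
Qed.

Lemma ideal_gen1 s : ideal_gen [set s] = pideal s :> set R.
Proof.
apply/seteqP; split; first by apply: gen_sub => _ ->; exists 1; rewrite mulr1.
by move=> _ [y ->]; apply: (idealMr (I := ideal_gen _)); exact: sub_gen.
Qed.

Lemma ideal_exp_pideal J t k : J = pideal t :> set R ->
  ideal_exp J k = pideal (t ^+ k) :> set R.
Proof.
move=> Jt; elim: k => [|k IHk]; apply/seteqP; split => // x.
- by move=> _; exists x; rewrite expr0 mul1r.
- move: x; apply: gen_sub => _ [i [j [+ + ->]]]; rewrite /ideal_mem Jt.
  rewrite -/(ideal_exp J k) IHk => -[y ->] [z ->]; exists (y * z).
  by rewrite mulrACA exprS.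
- case=> y ->; apply: sub_gen; exists t, (t ^+ k * y).
  split; last by rewrite exprS mulrA.
    by rewrite /ideal_mem Jt; exists 1; rewrite mulr1.
  by rewrite /ideal_mem -/(ideal_exp J k) IHk; exists y.
Qed.

Definition separated_at t := forall x, (forall k, pideal (t ^+ k) x) -> x = 0.

(** Completeness in terms of series: a [t]-adic Cauchy sequence has a subsequence whose consecutive
    differences are of the form [t ^+ i * u i]. *)
Definition summable_at t := forall u : nat -> R,
  exists s, forall k, pideal (t ^+ k) (s - \sum_(i < k) t ^+ i * u i).

Definition complete_at t := separated_at t /\ summable_at t.

End PrincipalIdeals.

Section PreimageIdeal.
Variables (R S : comPzRingType) (f : {rmorphism R -> S}) (J : ideal S).

Fact preim0 : (f @^-1` J) 0.
Proof. by rewrite /preimage /= rmorph0; exact: ideal0. Qed.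
Fact preimD x y : (f @^-1` J) x -> (f @^-1` J) y -> (f @^-1` J) (x + y).
Proof. by rewrite /preimage /= rmorphD; exact: idealD. Qed.
Fact preimMl r x : (f @^-1` J) x -> (f @^-1` J) (r * x).
Proof. by rewrite /preimage /= rmorphM; exact: idealMl. Qed.

Definition preim_ideal : ideal R := Ideal preim0 preimD preimMl.

End PreimageIdeal.

Definition rmorph_of (R S : comPzRingType) (f : R -> S) (fB : zmod_morphism f)
    (fM : monoid_morphism f) : {rmorphism R -> S} :=
  HB.pack_for (GRing.RMorphism.type R S) f (GRing.isZmodMorphism.Build _ _ f fB)
    (GRing.isMonoidMorphism.Build _ _ f fM).

Lemma pideal_rmorph (R S : comPzRingType) (f : {rmorphism R -> S}) (s x : R) :
  pideal s x -> pideal (f s) (f x).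
Proof. by case=> y ->; exists (f y); rewrite rmorphM. Qed.

Lemma complete_at_iso (R S : comPzRingType) (g : {rmorphism R -> S})
    (f : S -> R) t :
  cancel g f -> cancel f g -> complete_at (g t) -> complete_at t.
Proof.
move=> gK fK [sepS sumS]; split.
  move=> x xP; apply: (can_inj gK); rewrite rmorph0; apply: sepS => k.
  by rewrite -rmorphXn; apply: pideal_rmorph.
move=> u; have [s sP] := sumS (g \o u); exists (f s) => k.
have [y sy] := sP k; exists (f y); apply: (can_inj gK).
rewrite rmorphB rmorphM rmorphXn !fK rmorph_sum -sy; congr (_ - _).
by apply: eq_bigr => i _; rewrite rmorphM rmorphXn.
Qed.

Lemma ideal_ext_pideal (A : comPzRingType) (a : ideal A) (t : A) (B : alg A) :
  a = pideal t :> set A -> ideal_ext B a = pideal (alg_map B t) :> set B.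
Proof.
move=> at_; apply/seteqP; split.
  by apply: gen_sub => _ [x + <-]; rewrite at_; exact: pideal_rmorph.
move=> _ [y ->]; apply/(idealMr (I := ideal_gen _))/sub_gen; exists t => //.
by rewrite at_; exists 1; rewrite mulr1.
Qed.

Lemma ideal_ext_exp_pideal (A : comPzRingType) (a : ideal A) (t : A) (B : alg A)
    k : a = pideal t :> set A ->
  ideal_ext B (ideal_exp a k) = pideal (alg_map B t ^+ k) :> set B.
Proof.
move=> /(@ideal_exp_pideal _ _ _ k) /(@ideal_ext_pideal _ _ _ B) ->.
by rewrite rmorphXn.
Qed.

(** * The completion along a principal ideal: its topology, completeness and universal property *)

Section CompletionTheory.
Variables (R : comPzRingType) (J : ideal R) (t : R).
Hypothesis Jt : J = pideal t :> set R.
Local Notation Q := (completion J).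

Lemma quot_pi_exp0 k x : quot_pi (ideal_exp J k) x = 0 <-> pideal (t ^+ k) x.
Proof.
rewrite -(rmorph0 (quot_pi (ideal_exp J k))) quot_piP subr0.
by rewrite /ideal_mem (ideal_exp_pideal k Jt).
Qed.

Lemma transitionE k x :
  transition J k (quot_pi (ideal_exp J k.+1) x) = quot_pi (ideal_exp J k) x.
Proof. exact: quot_liftE. Qed.

Lemma completion_dense (x : Q) k : exists r, comp_seq x k = quot_pi _ r.
Proof. by exists (repr (comp_seq x k)); rewrite quot_reprK. Qed.

Lemma comp_seqB (x y : Q) k : comp_seq (x - y) k = comp_seq x k - comp_seq y k.
Proof. by []. Qed.

Lemma completion_reprs (x : Q) : exists r v : nat -> R,
  [/\ forall j, quot_pi (ideal_exp J j) (r j) = comp_seq x j &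
      forall j, r j.+1 = r j + t ^+ j * v j].
Proof.
pose r j := repr (comp_seq x j).
have rP j : quot_pi (ideal_exp J j) (r j) = comp_seq x j by exact: quot_reprK.
suff /choice[v vP] j : exists v, r j.+1 = r j + t ^+ j * v by exists r, v.
have /quot_pi_exp0[v rv] : quot_pi (ideal_exp J j) (r j.+1 - r j) = 0.
  by rewrite rmorphB /= (rP j) -transitionE (rP j.+1) compP subrr.
by exists v; rewrite -rv addrC subrK.
Qed.

(* Writing successive representatives as r_(j+1) = r_j + t^j v_j, the quotient
   of x by t^k is the sum of the series r_k / t^k + \sum_i t^i v_(k+i). *)
Lemma comp_seq_eq0 (x : Q) k :
  comp_seq x k = 0 <-> pideal (to_completion J t ^+ k) x.
Proof.
split; last first.
  case=> y ->; rewrite -rmorphXn /=.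
  have [r ry] := completion_dense y k.
  change (quot_pi (ideal_exp J k) (t ^+ k) * comp_seq y k = 0).
  by rewrite ry -rmorphM; apply/quot_pi_exp0; exists r.
move=> xk0; have [r [v [rP vP]]] := completion_reprs x.
have rD j : r (k + j)%N = r k + t ^+ k * \sum_(i < j) t ^+ i * v (k + i)%N.
  elim: j => [|j IHj]; first by rewrite big_ord0 mulr0 addr0 addn0.
  rewrite addnS vP IHj big_ord_recr /= mulrDr addrA exprD; congr (_ + _).
  by rewrite mulrA.
have [s rs] : pideal (t ^+ k) (r k) by apply/quot_pi_exp0; rewrite rP.
pose y j := quot_pi (ideal_exp J j) (s + \sum_(i < j) t ^+ i * v (k + i)%N).
have yP j : transition J j (y j.+1) = y j.
  rewrite transitionE big_ord_recr /= addrA rmorphD /=.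
  rewrite (_ : quot_pi _ (_ * _) = 0) ?addr0 //.
  by apply/quot_pi_exp0; exists (v (k + j)%N).
exists (Completion yP); apply: completion_inj => j; rewrite -rmorphXn /=.
change (comp_seq x j = quot_pi (ideal_exp J j) (t ^+ k) * y j).
rewrite -rmorphM mulrDr -rs -rD -rP.
elim: {yP y rD} k {xk0 rs} => [|k IHk] //.
rewrite addSn vP rmorphD -IHk [X in _ + X](_ : _ = 0) ?addr0 //.
apply/quot_pi_exp0; apply: (@pideal_exp_le _ _ _ (k + j)).
  exact: leq_addl.
by exists (v (k + j)%N).
Qed.

Lemma completion_complete : complete_at (to_completion J t).
Proof.
split=> [x xP|u]; first by apply: completion_inj => k; exact/comp_seq_eq0.
(* Terms of index at least [k] vanish in the [k]-th component, so the [k]-th partial sum determines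
   the [k]-th component of the limit. *)
pose s k := comp_seq (\sum_(i < k) to_completion J t ^+ i * u i) k.
have sP k : transition J k (s k.+1) = s k.
  rewrite /s compP; apply/subr0_eq.
  set s1 := \sum_(i < _) _; set s0 := \sum_(i < _) _.
  change (comp_seq (s1 - s0) k = 0); apply/comp_seq_eq0; exists (u k).
  by rewrite /s1 big_ord_recr addrAC subrr add0r.
by exists (Completion sP) => k; apply/comp_seq_eq0; rewrite comp_seqB subrr.
Qed.

Lemma completion_split (x : Q) k :
  exists r y, x = to_completion J r + to_completion J t ^+ k * y.
Proof.
exists (repr (comp_seq x k)).
have /comp_seq_eq0[y xy] :
    comp_seq (x - to_completion J (repr (comp_seq x k))) k = 0.
  by rewrite comp_seqB /= quot_reprK subrr.
by exists y; rewrite -xy addrC subrK.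
Qed.

Section Extend.
Variables (S : comPzRingType) (g : {rmorphism R -> S}).
Hypothesis cS : complete_at (g t).

(** The value is the limit of [g] along a sequence of representatives. Allowing every representative
    [r] makes it independent of choices, so that the ring laws can be checked modulo each power of
    [g t]. *)
Lemma completion_value (x : Q) : exists y, forall k r,
  comp_seq x k = quot_pi (ideal_exp J k) r -> pideal (g t ^+ k) (y - g r).
Proof.
have [r [v [rP vP]]] := completion_reprs x.
have rE j : r j = r 0%N + \sum_(i < j) t ^+ i * v i.
  elim: j => [|j IHj]; first by rewrite big_ord0 addr0.
  by rewrite vP IHj big_ord_recr /= addrA.
have [s sP] := cS.2 (g \o v); exists (g (r 0%N) + s) => k z.
rewrite -rP rE => /eqP; rewrite -subr_eq0 -rmorphB => /eqP /quot_pi_exp0.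
move=> /(pideal_rmorph g); rewrite rmorphXn => rz.
apply: (ideal_eq (idealD rz (sP k))). rewrite !(rmorphB, rmorphD) rmorph_sum.
under eq_bigr do rewrite rmorphM rmorphXn.
by rewrite /=; ring.
Qed.

Lemma completion_extend :
  exists f : {rmorphism Q -> S}, forall r, f (to_completion J r) = g r.
Proof.
have /choice[f fP] := completion_value.
have fE x y : (forall k, exists2 r, comp_seq x k = quot_pi _ r &
    pideal (g t ^+ k) (y - g r)) -> f x = y.
  move=> xy; apply/subr0_eq/cS.1 => k.
  have [r xr yr] := xy k; apply: (ideal_eq (idealB (fP x k r xr) yr)); ring.
have f_zmod : zmod_morphism f.
  move=> x y; apply: fE => k.
  have [[r xr] [s ys]] := (completion_dense x k, completion_dense y k).
  exists (r - s); first by rewrite comp_seqB xr ys rmorphB.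
  apply: (ideal_eq (idealB (fP x k r xr) (fP y k s ys))); rewrite rmorphB; ring.
have f_monoid : monoid_morphism f.
  split=> [|x y]; apply: fE => k.
    exists 1 => //; rewrite rmorph1 subrr; exact: ideal0.
  have [[r xr] [s ys]] := (completion_dense x k, completion_dense y k).
  exists (r * s).
    change (comp_seq x k * comp_seq y k = quot_pi (ideal_exp J k) (r * s)).
    by rewrite xr ys rmorphM.
  have fx := idealMr (f y) (fP x k r xr).
  have fy := idealMl (g r) (fP y k s ys).
  by apply: (ideal_eq (idealD fx fy)); rewrite rmorphM; ring.
exists (rmorph_of f_zmod f_monoid) => r /=.
apply: fE => k; exists r => //; rewrite subrr; exact: ideal0.
Qed.

End Extend.

(** [R] is dense in the completion, and two maps that agree on a dense subring differ by multiples
    of every power of the image of [t]. *)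
Lemma completion_rmorph_eq (S : comPzRingType) (f g : {rmorphism Q -> S}) :
    separated_at (f (to_completion J t)) ->
  (forall r, f (to_completion J r) = g (to_completion J r)) -> f =1 g.
Proof.
move=> sepS fg x; apply/subr0_eq/sepS => k.
have [r [y ->]] := completion_split x k.
rewrite !rmorphD !rmorphM !rmorphXn !fg; exists (f y - g y); ring.
Qed.

Lemma adic_complete_at : adic_complete J -> complete_at t.
Proof.
by case=> f fK Kf; apply: complete_at_iso fK Kf completion_complete.
Qed.

End CompletionTheory.

(** * Noetherian rings *)

Definition seq_noetherian (R : comPzRingType) : Prop :=
  forall I : ideal R, exists s : seq R, I = ideal_gen [set` s] :> set R.

Lemma noetherian_seq (R : comPzRingType) : noetherian R -> seq_noetherian R.
Proof.
by move=> nR I; have [S /finite_seqP[s ->] ->] := nR I; exists s.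
Qed.

Lemma gen_mono (R : comPzRingType) (S S' : set R) :
  S `<=` S' -> ideal_gen S `<=` ideal_gen S'.
Proof. by move=> SS'; apply: gen_sub => x /SS'; exact: sub_gen. Qed.

Lemma gen_cons (R : comPzRingType) (x y : R) (s : seq R) :
  ideal_gen [set` x :: s] y ->
  exists c z, ideal_gen [set` s] z /\ y = c * x + z.
Proof.
pose K : set R := [set y | exists c z, ideal_gen [set` s] z /\ y = c * x + z].
have K0 : K 0.
  by exists 0, 0; split; [exact: ideal0|rewrite mul0r addr0].
have KD u v : K u -> K v -> K (u + v).
  move=> [c [z [sz ->]]] [d [w [sw ->]]]; exists (c + d), (z + w).
  by split; [exact: idealD|ring].
have KM r u : K u -> K (r * u).
  move=> [c [z [sz ->]]]; exists (r * c), (r * z).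
  by split; [exact: idealMl|ring].
apply: (@gen_sub _ _ (Ideal K0 KD KM)) => z /=; rewrite inE => /predU1P[->|sz].
  by exists 1, 0; split; [exact: ideal0|ring].
by exists 0, z; split; [exact: sub_gen|ring].
Qed.

Lemma seq_noetherian_surj (R S : comPzRingType) (f : {rmorphism R -> S}) :
  surjective f -> seq_noetherian R -> seq_noetherian S.
Proof.
move=> fS nR I.
have [s Js] := nR (preim_ideal f I); exists (map f s).
apply/seteqP; split.
  move=> y; have [x <-] := fS y => Ix.
  have : ideal_gen [set` s] x by rewrite /ideal_mem -Js.
  move=> [p ps ->]; rewrite rmorph_sum big_seq.
  apply: (@ideal_sum _ _ _ _ _ (ideal_gen _)) => i /ps is_.
  by rewrite rmorphM; apply/idealMl/sub_gen/map_f.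
apply: gen_sub => _ /mapP[x sx ->].
suff : ideal_set (preim_ideal f I) x by [].
by rewrite Js; apply: sub_gen.
Qed.

(** The union of the chain is an ideal, and its finitely many generators already lie in a common
    member. *)
Lemma seq_noetherian_acc (R : comPzRingType) (L : nat -> ideal R) :
    seq_noetherian R -> (forall i, L i `<=` L i.+1) ->
  exists N, forall i, L i `<=` L N.
Proof.
move=> nR LS.
have LD i j : L i `<=` L (i + j)%N.
  elim: j => [|j IHj]; first by rewrite addn0.
  by rewrite addnS; exact: subset_trans IHj (LS _).
have LM i j x : (i <= j)%N -> L i x -> L j x.
  by move=> /subnKC <-; exact: LD.
pose K : set R := [set x | exists i, L i x].
have K0 : K 0 by exists 0%N; exact: ideal0.
have KD x y : K x -> K y -> K (x + y).
  move=> [i Lx] [j Ly]; exists (maxn i j).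
  by apply: idealD; [apply: LM Lx|apply: LM Ly]; lia.
have KM r x : K x -> K (r * x) by move=> [i Lx]; exists i; exact: idealMl.
have [s Ks] := nR (Ideal K0 KD KM).
have sK x : x \in s -> K x.
  move=> sx; change (ideal_set (Ideal K0 KD KM) x).
  by rewrite Ks; apply: sub_gen.
have [N sN] : exists N, forall x, x \in s -> L N x.
  elim: s sK {Ks} => [|y s IHs] sK; first by exists 0%N.
  have [x sx|N sN] := IHs; first by apply: sK; rewrite inE sx orbT.
  have [i Ly] := sK y (mem_head _ _); exists (maxn N i) => x.
  rewrite inE => /predU1P[->|/sN Lx]; first by apply: LM Ly; lia.
  by apply: LM Lx; lia.
exists N => i x Lx; apply: (@gen_sub _ [set` s]) => //.
suff : ideal_set (Ideal K0 KD KM) x by rewrite Ks.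
by exists i.
Qed.

(* Common core of Hilbert's basis theorem and of its t-adic analogue: L G i is
   the ideal of i-th leading, resp. initial, coefficients of elements of G. *)
Lemma seq_noetherian_chain_gen (R S : comPzRingType) (K : ideal S)
    (L : ideal S -> nat -> ideal R) :
    seq_noetherian R ->
    (forall G i, L G i `<=` L G i.+1) ->
    (forall i r, L K i r -> exists2 f, K f &
       forall G : ideal S, G f -> L G i r) ->
  exists N (s : seq S), [set` s] `<=` K /\
    forall i, L K i `<=` L (ideal_gen [set` s]) (minn i N).
Proof.
move=> nR LS LE.
have [N LN] := seq_noetherian_acc nR (LS K).
have [F FP] : exists F : nat -> R -> S, forall i r, L K i r ->
    K (F i r) /\ forall G : ideal S, G (F i r) -> L G i r.
  have /choice[F FP] : forall q : nat * R, exists f, L K q.1 q.2 ->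
      K f /\ forall G : ideal S, G f -> L G q.1 q.2.
    move=> [i r]; have [/LE[f Kf fG]|nL] := pselect (L K i r); last by exists 0.
    by exists f.
  by exists (fun i r => F (i, r)) => i r; exact: (FP (i, r)).
have /choice[s sP] i := nR (L K i).
have sL i r : r \in s i -> L K i r.
  by move=> sr; rewrite /ideal_mem sP; exact: sub_gen.
(* Only generators of [L K i] with [i <= N] are lifted; from [N] on the chain [L K] is stationary,
   whence the index [minn i N]. *)
pose G := flatten [seq [seq F i r | r <- s i] | i <- iota 0 N.+1].
have LG i : (i <= N)%N -> L K i `<=` L (ideal_gen [set` G]) i.
  move=> iN x; rewrite sP; apply: gen_sub => r /= sr.
  have [_] := FP i r (sL _ _ sr); apply; apply: sub_gen => /=.
  apply/flatten_mapP; exists i; first by rewrite mem_iota; lia.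
  exact: map_f.
exists N, G; split.
  by move=> _ /flatten_mapP[i _ /mapP[r /sL /FP[Kf _] ->]].
move=> i x Lx; have [iN|Ni] := leqP i N; first exact: LG.
by apply: LG => //; exact: LN Lx.
Qed.

(** * Hilbert's basis theorem *)

Section HilbertBasis.
Variable R : comNzRingType.
Implicit Types (K G : ideal {poly R}) (d : nat).

Let lead K d : set R :=
  [set r | exists f : {poly R}, [/\ K f, (size f <= d.+1)%N & f`_d = r]].

Fact lead0 K d : lead K d 0.
Proof. by exists 0; rewrite size_poly0 coef0; split=> //; exact: ideal0. Qed.
Fact leadD K d x y : lead K d x -> lead K d y -> lead K d (x + y).
Proof.
move=> [f [Kf sf <-]] [g [Kg sg <-]]; exists (f + g).
split; [exact: idealD|apply: leq_trans (size_polyD _ _) _|by rewrite coefD].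
by rewrite geq_max sf.
Qed.
Fact leadMl K d r x : lead K d x -> lead K d (r * x).
Proof.
move=> [f [Kf sf <-]]; exists (r *: f); split; last by rewrite coefZ.
  by rewrite -mul_polyC; exact: idealMl.
exact: leq_trans (size_scale_leq _ _) sf.
Qed.
Definition lead_ideal K d : ideal R :=
  Ideal (lead0 K d) (@leadD K d) (@leadMl K d).

Lemma lead_idealS K d : lead_ideal K d `<=` lead_ideal K d.+1.
Proof.
move=> _ [f [Kf sf <-]]; exists (f * 'X).
split; [exact: idealMr| |by rewrite coefMX].
have [->|f0] := eqVneq f 0; first by rewrite mul0r size_poly0.
by rewrite size_mulX.
Qed.

Lemma lead_ideal_le K i j : (i <= j)%N -> lead_ideal K i `<=` lead_ideal K j.
Proof.
move=> /subnKC <-; elim: (j - i)%N => [|k IHk]; first by rewrite addn0.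
by rewrite addnS; apply: subset_trans IHk (@lead_idealS _ _).
Qed.

(** Induction on a bound for the size of [f]: subtracting an element of [G] with the same top
    coefficient lowers the bound and stays in [K]. *)
Lemma lead_ideal_sub K G :
  G `<=` K -> (forall d, lead_ideal K d `<=` lead_ideal G d) -> K `<=` G.
Proof.
move=> GK KG f Kf; move: {2}(size f) (leqnn (size f)) => d.
elim: d f Kf => [|d IHd] f Kf sf.
  by move: sf; rewrite leqn0 size_poly_eq0 => /eqP ->; exact: ideal0.
have [|g [Gg sg fg]] := KG d f`_d; first by exists f.
rewrite -(subrK g f); apply: (idealD (i := G)) => //; apply: IHd.
  by apply: idealB => //; exact: GK.
apply/leq_sizeP => j; rewrite leq_eqVlt coefB => /predU1P[<-|dj].
  by rewrite fg subrr.
rewrite !nth_default ?subrr //; [exact: leq_trans sg dj|].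
exact: leq_trans sf dj.
Qed.

Theorem poly_seq_noetherian : seq_noetherian R -> seq_noetherian {poly R}.
Proof.
move=> nR K.
have [i r [f [Kf sf fr]]|N [s [sK Ks]]] :=
    seq_noetherian_chain_gen (K := K) nR lead_idealS.
  by exists f => // G Gf; exists f.
exists s; apply/seteqP; split; last exact: gen_sub.
apply: lead_ideal_sub; first exact: gen_sub.
move=> d x /Ks; apply: lead_ideal_le; exact: geq_minl.
Qed.

End HilbertBasis.

(** * The [t]-adic analogue of the basis theorem *)

Section AdicNoetherian.
Variables (R P : comPzRingType) (iota : {rmorphism R -> P}) (t : P).
Hypothesis cP : complete_at t.
Hypothesis dense : forall x, exists r y, x = iota r + t * y.
Implicit Types K G : ideal P.

(** Coefficients of the lowest term: after factoring out [t ^+ i], the remaining factor is read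
    modulo [t], through a representative in [R]. *)
Let init K i : set R :=
  [set r | exists y, K (t ^+ i * (iota r + t * y))].

Fact init0 K i : init K i 0.
Proof. by exists 0; rewrite rmorph0 mulr0 addr0 mulr0; exact: ideal0. Qed.
Fact initD K i x y : init K i x -> init K i y -> init K i (x + y).
Proof.
move=> [u Kx] [v Ky]; exists (u + v).
by apply: (ideal_eq (idealD Kx Ky)); rewrite rmorphD; ring.
Qed.
Fact initMl K i r x : init K i x -> init K i (r * x).
Proof.
move=> [u Kx]; exists (iota r * u).
by apply: (ideal_eq (idealMl (iota r) Kx)); rewrite rmorphM; ring.
Qed.
Definition init_ideal K i : ideal R :=
  Ideal (init0 K i) (@initD K i) (@initMl K i).

Lemma init_idealS K i : init_ideal K i `<=` init_ideal K i.+1.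
Proof.
move=> r [y Ky]; exists y; rewrite exprS -mulrA; exact: idealMl.
Qed.

(** The coefficients of each of the finitely many generators are summed separately, so the limit can
    be taken inside the ideal. *)
Lemma gen_seq_summable (s : seq P) (u : nat -> P) :
    (forall i, ideal_gen [set` s] (u i)) ->
  exists2 z, ideal_gen [set` s] z &
    forall k, pideal (t ^+ k) (z - \sum_(i < k) t ^+ i * u i).
Proof.
elim: s u => [|x s IHs] u su.
  exists 0 => [|k]; first exact: ideal0.
  rewrite big1 ?subrr; first exact: ideal0.
  move=> i _; have [p ps ->] := su i; rewrite big_seq big1 ?mulr0 // => q.
  by move=> /ps.
have /choice[c /choice[v uE]] i := gen_cons (su i).
have [|z sz zP] := IHs v; first by move=> i; case: (uE i).
have [d dP] := cP.2 c; exists (d * x + z).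
  apply: idealD; first by apply/idealMl/sub_gen; rewrite /= mem_head.
  by apply: gen_mono sz => y /= sy; rewrite inE sy orbT.
move=> k; apply: (ideal_eq (idealD (idealMr x (dP k)) (zP k))).
rewrite mulrBl addrACA -opprD; congr (_ - _).
rewrite mulr_suml -big_split; apply: eq_bigr => i _ /=.
by rewrite (uE i).2; ring.
Qed.

Theorem adic_seq_noetherian : seq_noetherian R -> seq_noetherian P.
Proof.
move=> nR K.
have [i r [y Ky]|N [s [sK Ks]]] :=
    seq_noetherian_chain_gen (K := K) nR init_idealS.
  by exists (t ^+ i * (iota r + t * y)) => // G Gf; exists y.
have sK' : ideal_gen [set` s] `<=` K by exact: gen_sub.
exists s; apply/seteqP; split => // x Kx.
have step i x' : K (t ^+ i * x') ->
    exists2 g, ideal_gen [set` s] (t ^+ minn i N * g) &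
      exists y, x' = g + t * y.
  have [r [y ->]] := dense x' => Kx'.
  have [|z Gz] := Ks i r; first by exists y.
  by exists (iota r + t * z) => //; exists (y - z); ring.
(* The first [N] reductions, where the exponent is not yet capped, bring [x] into the generated
   ideal modulo [t ^+ N]. *)
have [z Gz [w xz]] :
    exists2 z, ideal_gen [set` s] z & exists w, x = z + t ^+ N * w.
  elim: {1 3}N (leqnn N) => [|i IHi] iN.
    by exists 0; [exact: ideal0|exists x; ring].
  have [z Gz [w xz]] := IHi (ltnW iN).
  have [|g Gg [y wy]] := step i w.
    have -> : t ^+ i * w = x - z by rewrite xz; ring.
    by apply: idealB => //; exact: sK'.
  exists (z + t ^+ i * g); last by exists y; rewrite xz wy exprS; ring.
  by apply: idealD => //; rewrite -(minn_idPl (ltnW iN)).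
(* From [N] on the multiplier stays [t ^+ N]: the successive remainders [e i] give corrections that
   all lie in the generated ideal and are summed with weights [t ^+ i]. *)
have [e [e0 eS]] : exists e : nat -> P, e 0%N = w /\
    forall i, K (t ^+ (N + i) * e i) ->
      ideal_gen [set` s] (t ^+ N * (e i - t * e i.+1)).
  have /choice[nx nxP] : forall q : nat * P, exists y,
      K (t ^+ (N + q.1) * q.2) ->
      ideal_gen [set` s] (t ^+ N * (q.2 - t * y)).
    move=> [i v] /=.
    have [/step[g + [y vy]]|nK] := pselect (K (t ^+ (N + i) * v)).
      rewrite (minn_idPr (leq_addr i N)) => Gg; exists y => _.
      by rewrite vy addrK.
    by exists 0.
  exists (fix e i := if i is i'.+1 then nx (i', e i') else w); split => //.
  by move=> i; exact: (nxP (i, _)).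
have eK i : K (t ^+ (N + i) * e i).
  elim: i => [|i IHi].
    rewrite addn0 e0 (_ : _ * w = x - z); last by rewrite xz; ring.
    by apply: idealB => //; exact: sK'.
  apply: (ideal_eq (idealB IHi (idealMl (t ^+ i) (sK' _ (eS i IHi))))).
  by rewrite addnS exprS exprD; ring.
have [v Gv vP] := gen_seq_summable (fun i => eS i (eK i)).
suff -> : x = z + v by exact: idealD.
apply/subr0_eq/cP.1 => k.
(* The series telescopes: its partial sums are [t ^+ N * (w - t ^+ k * e k)]. *)
have -> : x - (z + v) = t ^+ k * (t ^+ N * e k) -
    (v - \sum_(i < k) t ^+ i * (t ^+ N * (e i - t * e i.+1))).
  suff -> : \sum_(i < k) t ^+ i * (t ^+ N * (e i - t * e i.+1)) =
      t ^+ N * (w - t ^+ k * e k) by rewrite xz; ring.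
  elim: k => [|k IHk]; first by rewrite big_ord0 e0; ring.
  by rewrite big_ord_recr /= IHk exprS; ring.
by apply: idealB => //; exists (t ^+ N * e k).
Qed.

End AdicNoetherian.

(** * Restricted power series *)

Lemma triv_comPz (R : comPzRingType) : (1 : R) = 0 -> forall x y : R, x = y.
Proof. by move=> R0 x y; rewrite -(mul1r x) -(mul1r y) R0 !mul0r. Qed.

Section MPoly.
Variables (A : comNzRingType) (m : nat).

Lemma mpoly_rmorph_eq (S : pzRingType) (f g : {rmorphism {mpoly A[m]} -> S}) :
  (forall a, f a%:MP = g a%:MP) -> (forall i, f 'X_i = g 'X_i) -> f =1 g.
Proof.
move=> fgC fgX p; rewrite (mpolyE p) !rmorph_sum; apply: eq_bigr => u _.
rewrite -mul_mpolyC !rmorphM fgC mpolyXE_id !rmorph_prod; congr (_ * _).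
by apply: eq_bigr => i _; rewrite !rmorphXn fgX.
Qed.

Lemma mpoly_eval (S : comPzRingType) (f : {rmorphism A -> S}) (c : 'I_m -> S) :
  exists g : {rmorphism {mpoly A[m]} -> S},
    (forall a, g a%:MP = f a) /\ (forall i, g 'X_i = c i).
Proof.
have [/eqP S0|S1] := boolP ((1 : S) == 0).
  exists (rmorph_of (f := fun _ : {mpoly A[m]} => 0 : S)
    (fun _ _ => esym (subr0 _)) (conj (esym S0) (fun _ _ => esym (mulr0 _)))).
  by split=> *; exact: triv_comPz.
pose S' := nontrivial S1; pose f' : {rmorphism A -> S'} := f.
exists (mmap f' (c : 'I_m -> S') : {rmorphism {mpoly A[m]} -> S'}).
by split=> [a|i] /=; [rewrite mmapC|rewrite mmapX mmap1U].
Qed.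

(** Variables are adjoined one at a time by [{poly T}]. The induction records only which elements
    are in the image of [f]; for [k = m] this makes [f] surjective. *)
Lemma mpoly_seq_noetherian : seq_noetherian A -> seq_noetherian {mpoly A[m]}.
Proof.
move=> nA.
have adjoin k : (k <= m)%N -> exists (T : comNzRingType)
    (f : {rmorphism T -> {mpoly A[m]}}),
    [/\ seq_noetherian T, forall a, exists x, f x = a%:MP &
        forall i : 'I_m, (i < k)%N -> exists x, f x = 'X_i].
  elim: k => [|k IHk] km.
    by exists A, (@mpolyC m A); split=> // a; exists a.
  have [T [f [nT fC fX]]] := IHk (ltnW km).
  pose u : {mpoly A[m]} := 'X_(Ordinal km).
  have cfu : commr_rmorph f u by move=> x; exact: mulrC.
  exists {poly T}, (horner_morph cfu); split; first exact: poly_seq_noetherian.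
    by move=> a; have [x <-] := fC a; exists x%:P; rewrite /= horner_morphC.
  move=> i; rewrite ltnS leq_eqVlt => /predU1P[ik|/fX[x <-]].
    by exists 'X; rewrite /= horner_morphX; congr 'X_ _; exact/val_inj.
  by exists x%:P; rewrite /= horner_morphC.
have [T [f [nT fC fX]]] := adjoin m (leqnn m).
apply: (@seq_noetherian_surj _ _ f _ nT) => p; rewrite (mpolyE p).
elim/big_ind: _ => [|_ _ [x <-] [y <-]|u _]; first by exists 0; rewrite rmorph0.
  by exists (x + y); rewrite rmorphD.
have [a fa] := fC p@_u.
have /choice[x xP] : forall i, exists x, f x = 'X_i by move=> i; exact: fX.
exists (a * \prod_i x i ^+ u i).
rewrite rmorphM rmorph_prod /= fa mul_mpolyC mpolyXE_id; congr (_ *: _).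
by apply: eq_bigr => i _; rewrite rmorphXn xP.
Qed.

End MPoly.

Section RestrictedPowerSeries.
Variables (A : comPzRingType) (m : nat).

(** Hides the case distinction on [1 != 0] in [poly_alg] behind a universal property. *)
Definition poly_alg_universal (U : alg A) : Prop := exists X : 'I_m -> U,
  [/\ forall (C : alg A) (c : 'I_m -> C),
        exists g : alg_hom U C, forall i, g (X i) = c i,
      forall (C : alg A) (f g : alg_hom U C),
        (forall i, f (X i) = g (X i)) -> f =1 g &
      seq_noetherian A -> seq_noetherian U].

Lemma poly_alg_spec : poly_alg_universal (poly_alg A m).
Proof.
(* The body of [poly_alg] with [boolP] abstracted to a variable [q], so that it can be analysed by
   cases. *)
pose U b (q : alt_spec ((1 : A) != 0) ((1 : A) != 0) b) : alg A :=
  match q with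
  | AltTrue A1 =>
    let A' := nontrivial A1 in
    @Alg A {mpoly A'[m]} (@mpolyC m A' : {rmorphism A' -> {mpoly A'[m]}})
  | AltFalse _ => @Alg A A idfun
  end.
suff UP b q : poly_alg_universal (@U b q) by exact: (UP _ (boolP _)).
case: q => A1 /=.
  pose A' := nontrivial A1; exists (fun i => 'X_i : {mpoly A'[m]}); split.
  - move=> C c; have [g [gC gX]] := mpoly_eval (A := A') (alg_map C) c.
    pose U' := @Alg A {mpoly A'[m]} (@mpolyC m A' : {rmorphism A' -> _}).
    by exists (@AlgHom A U' C g gC).
  - move=> C f g fg; apply: (mpoly_rmorph_eq (A := A')) => // a.
    exact: etrans (hom_alg f a) (esym (hom_alg g a)).
  - move=> nA; apply: (@mpoly_seq_noetherian A').
    apply: (@seq_noetherian_surj A A' (idfun : {rmorphism A -> A}) _ nA) => x.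
    by exists x.
have A0 : 1 = 0 :> A by apply/eqP/negPn.
have C0 (C : alg A) : 1 = 0 :> C.
  by rewrite -(rmorph1 (alg_map C)) A0 rmorph0.
exists (fun=> 0); split=> //.
- move=> C c; exists (@AlgHom A (@Alg A A idfun) C (alg_map C) (fun=> erefl)).
  by move=> i; exact: triv_comPz.
- by move=> C f g _ x; exact: triv_comPz.
Qed.

Variables (a : ideal A) (t : A).
Hypothesis at_ : a = pideal t :> set A.
Local Notation P := (restricted_alg a m).

(** Evaluation of polynomials extends to the completion. Uniqueness assumes only a separated target,
    which allows targets such as [red C a k] and quotients of [S]. *)
Lemma restricted_alg_spec : exists X : 'I_m -> P,
  [/\ forall (C : alg A) (c : 'I_m -> C), complete_at (alg_map C t) ->
        exists g : alg_hom P C, forall i, g (X i) = c i,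
      forall (C : alg A) (f g : alg_hom P C), separated_at (alg_map C t) ->
        (forall i, f (X i) = g (X i)) -> f =1 g &
      seq_noetherian A -> seq_noetherian P].
Proof.
have [X [XE Xeq Xn]] := poly_alg_spec.
have Jt := ideal_ext_pideal (poly_alg A m) at_.
pose J := ideal_ext (poly_alg A m) a.
exists (fun i => to_completion J (X i)); split.
- move=> C c cC; have [g gX] := XE C c.
  have [|f fE] := completion_extend Jt (g := g); first by rewrite hom_alg.
  have fA b : f (alg_map P b) = alg_map C b by rewrite /= fE hom_alg.
  by exists (@AlgHom _ P C f fA) => i; rewrite /= fE.
- move=> C f g sC fgX; apply: (completion_rmorph_eq Jt).
    by have := hom_alg f t; rewrite /= => ->.
  have fA (h : alg_hom P C) b :
    ((h : {rmorphism P -> C}) \o to_completion J) (alg_map _ b) = alg_map C b.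
    exact: hom_alg.
  exact: (Xeq C (AlgHom (fA f)) (AlgHom (fA g))).
- move=> nA; apply: (adic_seq_noetherian (completion_complete Jt)) (Xn nA).
  move=> x; have [r [y ->]] := completion_split Jt x 1; exists r, y.
  by rewrite expr1.
Qed.

End RestrictedPowerSeries.

(** * Extensions and derivations *)

Section KernelModule.
Variables (A : comPzRingType) (E B : alg A) (q : alg_hom E B).

Definition kmod : Type := {x : E | q x == 0}.
HB.instance Definition _ := Choice.on kmod.

Lemma kmodP (u : kmod) : q (val u) = 0.
Proof. exact/eqP/(valP u). Qed.

Definition Kmod x (qx : q x = 0) : kmod := exist _ x (introT eqP qx).

Fact kmod_add_subproof (u v : kmod) : q (val u + val v) = 0.
Proof. by rewrite rmorphD !kmodP addr0. Qed.
Fact kmod_opp_subproof (u : kmod) : q (- val u) = 0.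
Proof. by rewrite rmorphN kmodP oppr0. Qed.
Definition kmod_add u v := Kmod (kmod_add_subproof u v).
Definition kmod_opp u := Kmod (kmod_opp_subproof u).
Definition kmod0 := Kmod (rmorph0 q).

Fact kmod_addA : associative kmod_add.
Proof. by move=> u v w; apply: val_inj; exact: addrA. Qed.
Fact kmod_addC : commutative kmod_add.
Proof. by move=> u v; apply: val_inj; exact: addrC. Qed.
Fact kmod_add0 : left_id kmod0 kmod_add.
Proof. by move=> u; apply: val_inj; exact: add0r. Qed.
Fact kmod_addN : left_inverse kmod0 kmod_opp kmod_add.
Proof. by move=> u; apply: val_inj; exact: addNr. Qed.
HB.instance Definition _ :=
  GRing.isZmodule.Build kmod kmod_addA kmod_addC kmod_add0 kmod_addN.

Lemma kmod_valD (u v : kmod) : val (u + v) = val u + val v.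
Proof. by []. Qed.

Definition kmod_val (u : kmod) : E := val u.
Fact kmod_val_is_zmod : zmod_morphism kmod_val. Proof. by []. Qed.
HB.instance Definition _ :=
  GRing.isZmodMorphism.Build kmod E kmod_val kmod_val_is_zmod.

Hypothesis qS : surjective q.
Hypothesis q0M : forall x y, q x = 0 -> q y = 0 -> x * y = 0.

Let lift b : E := sval (cid (qS b)).
Let liftK b : q (lift b) = b. Proof. exact: svalP (cid (qS b)). Qed.

Fact kmod_scale_subproof b (u : kmod) : q (lift b * val u) = 0.
Proof. by rewrite rmorphM kmodP mulr0. Qed.
Definition kmod_scale b u := Kmod (kmod_scale_subproof b u).

(** Every preimage of a scalar acts in the same way, since two preimages differ by an element of the
    square-zero kernel. *)
Let scaleE d u : val (kmod_scale (q d) u) = d * val u.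
Proof.
apply/subr0_eq; rewrite /= -mulrBl; apply: q0M; last exact: kmodP.
by rewrite rmorphB liftK subrr.
Qed.

Fact kmod_scaleA b c u : kmod_scale b (kmod_scale c u) = kmod_scale (b * c) u.
Proof.
apply: val_inj; have [[x <-] [y <-]] := (qS b, qS c).
by rewrite -rmorphM !scaleE mulrA.
Qed.
Fact kmod_scale1 : left_id 1 kmod_scale.
Proof. by move=> u; apply: val_inj; rewrite -(rmorph1 q) scaleE mul1r. Qed.
Fact kmod_scaleDr : right_distributive kmod_scale +%R.
Proof.
move=> b u v; apply: val_inj; have [x <-] := qS b.
by rewrite kmod_valD !scaleE -mulrDr.
Qed.
Fact kmod_scaleDl u : {morph kmod_scale^~ u : b c / b + c}.
Proof.
move=> b c; apply: val_inj; have [[x <-] [y <-]] := (qS b, qS c).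
by rewrite -rmorphD kmod_valD !scaleE -mulrDl.
Qed.

Definition kmod_lmod : lmodType B := HB.pack_for (lmodType B) kmod
  (GRing.Zmodule_isLmodule.Build B kmod
    kmod_scaleA kmod_scale1 kmod_scaleDr kmod_scaleDl).

Definition kmod_inj : {additive kmod_lmod -> E} := kmod_val.

Fact kmod_injI : injective kmod_inj. Proof. exact: val_inj. Qed.
Fact kmod_exact d : q d = 0 <-> exists u, kmod_inj u = d.
Proof. by split=> [qd|[u <-]]; [exists (Kmod qd)|exact: kmodP]. Qed.
Fact kmod_sqr0 u v : kmod_inj u * kmod_inj v = 0.
Proof. by apply: q0M; exact: kmodP. Qed.
Fact kmod_modE d u : d * kmod_inj u = kmod_inj (q d *: u).
Proof. exact/esym/scaleE. Qed.

Definition kmod_ext : extension kmod_lmod :=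
  Extension kmod_injI qS kmod_exact kmod_sqr0 kmod_modE.

Lemma kmod_finite m (g : 'I_m -> E) : (forall i, q (g i) = 0) ->
    (forall x, q x = 0 -> exists c : 'I_m -> E, x = \sum_i c i * g i) ->
  finite_module kmod_lmod.
Proof.
move=> g0 gP; exists m, (fun i => Kmod (g0 i)) => u.
have [c uE] := gP _ (kmodP u); exists (q \o c); apply: kmod_injI.
rewrite raddf_sum -[LHS]/(val u) uE; apply: eq_bigr => i _.
by rewrite -kmod_modE.
Qed.

End KernelModule.

(* A trivialisation of b.E yields an A-algebra map E -> B (+) N whose first
   component is the projection; the second one is then a derivation. *)
Lemma ext_scale_trivial_derivation (A : comPzRingType) (B : alg A)
    (N : lmodType B) (E : extension N) (b : B) :
    ext_iso (ext_scale b E) (ext_trivial N) ->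
  exists d : E -> N,
    [/\ zmod_morphism d,
        forall x y, d (x * y) = ext_proj E x *: d y + ext_proj E y *: d x,
        forall a, d (alg_map E a) = 0 &
        forall u, d (ext_inj E u) = b *: u].
Proof.
move=> [f [_ f_inj f_proj]].
pose p : {rmorphism E -> B} := ext_proj E.
pose g : {linear N -> N} := *:%R b.
pose j : {rmorphism E -> ext_scale b E} :=
  quot_pi (push_ideal g E) \o sqz_inl p N.
have fj1 x : (f (j x)).1 = ext_proj E x.
  by have := f_proj (j x); rewrite [RHS]push_projE.
exists (fun x => (f (j x)).2); split.
- by move=> x y; rewrite !rmorphB.
- by move=> x y; rewrite !rmorphM /= !fj1.
- by move=> a; have /= -> := hom_alg f a.
(* The relation defining the pushout identifies [ext_inj E u] with the image of [b *: u]. *)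
- move=> u; rewrite (_ : j _ = ext_inj (ext_scale b E) (b *: u)); last first.
    apply/quot_piP; exists u; apply: sqz_eq => /=; first by rewrite subr0.
    by rewrite sub0r.
  by rewrite f_inj.
Qed.

Section Derivation.
Variables (A : comPzRingType) (P B : alg A) (p : alg_hom P B) (K : ideal P).
Hypothesis pS : surjective p.
Hypothesis Kp : forall x, K x <-> p x = 0.

Let K2 : ideal P := ideal_mul K K.
Let E : alg A := quot_alg K2.

Lemma square_sub x : K2 x -> p x = 0.
Proof.
move=> K2x; apply/Kp; move: x K2x; apply: gen_sub => _ [i [j [_ Kj ->]]].
exact: idealMl.
Qed.

Let pr : {rmorphism P -> E} := quot_pi K2.
Let prP x y : pr x = pr y <-> K2 (x - y). Proof. exact: quot_piP. Qed.

Let q_rm : {rmorphism E -> B} := quot_lift (f := p) square_sub.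
Let q_alg a : q_rm (alg_map E a) = alg_map B a.
Proof. by rewrite /q_rm /= quot_liftE hom_alg. Qed.
Let q : alg_hom E B := AlgHom q_alg.
Let qE x : q (pr x) = p x. Proof. exact: quot_liftE. Qed.
Let q_surj : surjective q.
Proof. by move=> b; have [x <-] := pS b; exists (pr x); rewrite qE. Qed.
Let q0M x y : q x = 0 -> q y = 0 -> x * y = 0.
Proof.
elim/quot_piW: x => x; elim/quot_piW: y => y; rewrite -/(pr x) -/(pr y) !qE.
move=> /Kp Kx /Kp Ky.
rewrite -(rmorph0 pr) -[LHS](rmorphM pr).
by apply/prP; rewrite subr0; apply: sub_gen; exists x, y.
Qed.

(** The derivation has values in [K / K2]; [D] picks representatives in [P], so each law holds
    modulo [K2]. It comes from the extension [P / K2] of [B], whose kernel is a finite module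
    because [s] generates [K]. *)
Lemma Hbar_derivation (s : seq P) (e : A) :
    K = ideal_gen [set` s] :> set P -> Hbar B (alg_map B e) ->
  exists D : P -> P,
    [/\ forall x, K (D x),
        forall x y, K2 (D (x - y) - (D x - D y)),
        forall x y, K2 (D (x * y) - (x * D y + y * D x)),
        forall a, K2 (D (alg_map P a)) &
        forall x, K x -> K2 (D x - alg_map P e * x)].
Proof.
move=> Ks He.
have sK x : x \in s -> p x = 0.
  by move=> sx; apply/Kp; rewrite /ideal_mem Ks; apply: sub_gen.
have fin : finite_module (kmod_lmod q_surj q0M).
  apply: (@kmod_finite A E B q q_surj q0M (size s) (fun i => pr s`_i)).
    by move=> i; rewrite qE; apply: sK; exact: mem_nth.
  elim/quot_piW => x; rewrite -[quot_pi _ _]/(pr x) qE => /Kp.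
  rewrite /ideal_mem Ks => sx.
  suff [c ->] : exists c : 'I_(size s) -> P, x = \sum_i c i * s`_i.
    exists (pr \o c); rewrite (rmorph_sum pr).
    by apply: eq_bigr => i _; rewrite (rmorphM pr).
  elim: s x sx {Ks sK} => [|y s IHs] x sx.
    exists (fun=> 0); have [r rs ->] := sx.
    by rewrite big_ord0 big_seq big1 // => i /rs.
  have [c [z [/IHs[d ->] ->]]] := gen_cons sx.
  exists (fun i => if unlift ord0 i is Some j then d j else c).
  rewrite big_ord_recl unlift_none; congr (_ + _).
  by apply: eq_bigr => i _; rewrite liftK.
have [d [dB dM dA dK]] :=
  ext_scale_trivial_derivation (He _ fin (kmod_ext q_surj q0M)).
pose D x : P := repr (val (d (pr x))).
have DE x : pr (D x) = val (d (pr x)) by exact: quot_reprK.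
have K2E x : pr x = 0 <-> K2 x by rewrite -(rmorph0 pr) prP subr0.
exists D; split.
- by move=> x; apply/Kp; rewrite -qE DE; exact: kmodP.
- move=> x y; apply/prP; rewrite DE !(rmorphB pr) !DE.
  by rewrite [X in val X]dB.
- move=> x y; apply/prP; rewrite DE (rmorphD pr).
  rewrite !(rmorphM pr) !DE [X in val X]dM.
  by rewrite -[LHS]/(kmod_inj _ _ (_ + _)) raddfD -!kmod_modE.
- by move=> a; apply/K2E; rewrite DE [X in val X]dA.
- move=> x /Kp; rewrite -qE => qx; apply/prP.
  rewrite DE (rmorphM pr) -[pr x]/(kmod_inj q_surj q0M (Kmod qx)).
  rewrite [X in val X]dK -[LHS]/(kmod_inj _ _ (_ *: _)).
  by rewrite -[alg_map B e]q_alg -kmod_modE.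
Qed.

End Derivation.

(** * Lifting homomorphisms *)

Lemma torsion_exp (R : comPzRingType) (t : R) r :
    (forall x, pideal (t ^+ r) x -> t * x = 0 -> x = 0) ->
  forall k x, pideal (t ^+ r) x -> t ^+ k * x = 0 -> x = 0.
Proof.
move=> torsion; elim=> [|k IHk] x rx; first by rewrite mul1r.
rewrite exprS -mulrA => /torsion Tx; apply: IHk => //; apply: Tx.
exact: idealMl.
Qed.

Section AlgHom.
Variable A : comPzRingType.
Implicit Types B C D : alg A.

Definition comp_hom B C D (g : alg_hom C D) (f : alg_hom B C) : alg_hom B D :=
  @AlgHom A B D (g \o f)
    (fun a => etrans (congr1 g (hom_alg f a)) (hom_alg g a)).

Lemma alg_hom_of B C (f : B -> C) :
    zmod_morphism f -> monoid_morphism f ->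
    (forall a, f (alg_map B a) = alg_map C a) ->
  exists g : alg_hom B C, g =1 f.
Proof.
by move=> fB fM fA; exists (@AlgHom A B C (rmorph_of fB fM) fA).
Qed.

Lemma alg_hom_factor P B C (p : alg_hom P B) (f : alg_hom P C) :
    surjective p -> (forall x, p x = 0 -> f x = 0) ->
  exists g : alg_hom B C, forall x, g (p x) = f x.
Proof.
move=> pS fp; have /choice[l lP] := pS.
have fE x y : p x = p y -> f x = f y.
  by move=> pxy; apply/subr0_eq; rewrite -rmorphB fp // rmorphB pxy subrr.
have [||a|g gE] := @alg_hom_of B C (f \o l).
- by move=> x y; rewrite /= -rmorphB; apply: fE; rewrite rmorphB !lP.
- split=> [|x y] /=.
    by rewrite -(rmorph1 f); apply: fE; rewrite lP rmorph1.
  by rewrite -rmorphM; apply: fE; rewrite rmorphM !lP.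
- by rewrite /= -(hom_alg f); apply: fE; rewrite lP hom_alg.
- by exists g => x; rewrite gE /=; apply: fE.
Qed.

End AlgHom.

Section Lifting.
Variables (A : comPzRingType) (t : A) (P B S : alg A).
Variables (p : alg_hom P B) (n : nat) (X : 'I_n -> P).
Local Notation T := (alg_map S t).
Hypothesis pS : surjective p.
Hypothesis X_hom : forall (C : alg A) (c : 'I_n -> C),
  complete_at (alg_map C t) -> exists g : alg_hom P C, forall i, g (X i) = c i.
Hypothesis X_eq : forall (C : alg A) (f g : alg_hom P C),
  separated_at (alg_map C t) -> (forall i, f (X i) = g (X i)) -> f =1 g.
Hypothesis cS : complete_at T.

Variables (J : ideal S) (r h c : nat).
Hypothesis J_closed :
  forall x, (forall k, exists2 y, J y & pideal (T ^+ k) (x - y)) -> J x.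
Let Jk k : ideal S := ideal_cap (pideal (T ^+ k)) J.
Hypothesis J_AR : forall k x, (c <= k)%N -> Jk k x ->
  exists2 y, Jk c y & x = T ^+ (k - c) * y.
Hypothesis torsion : forall x, pideal (T ^+ r) x -> T * x = 0 -> x = 0.

Variables (K K2 : ideal P) (D : P -> P).
Hypothesis Kp : forall x, K x <-> p x = 0.
Hypothesis K2E : K2 = ideal_mul K K.
Hypothesis DK : forall x, K (D x).
Hypothesis DB : forall x y, K2 (D (x - y) - (D x - D y)).
Hypothesis DM : forall x y, K2 (D (x * y) - (x * D y + y * D x)).
Hypothesis DA : forall a, K2 (D (alg_map P a)).
Hypothesis DKE : forall x, K x -> K2 (D x - alg_map P (t ^+ h) * x).

Lemma Jk_le i j x : (i <= j)%N -> Jk j x -> Jk i x.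
Proof. by move=> ij [Tx Jx]; split=> //; exact: pideal_exp_le Tx. Qed.

Lemma Jk_mul i j x y : Jk i x -> Jk j y -> Jk (i + j) (x * y).
Proof.
move=> [[u ->] Jx] [[v ->] _]; split; last exact: idealMr.
by exists (u * v); rewrite exprD; ring.
Qed.

(** By Artin-Rees, dividing by [T ^+ h] does not leave [J]: the quotient is [T ^+ (k - c) * y] with
    [y] in [J]. *)
Lemma Jk_div k x : (c <= k)%N ->
  Jk (k + h) x -> exists2 y, Jk k y & x = T ^+ h * y.
Proof.
move=> ck /J_AR[|y [[z yz] Jy] ->]; first by lia.
exists (T ^+ (k - c) * y).
  split; last exact: idealMl.
  by exists z; rewrite yz mulrA -exprD; congr (T ^+ _ * _); lia.
by rewrite mulrA -exprD; congr (T ^+ _ * _); lia.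
Qed.

Lemma Jk_closed k x :
  (forall i, exists2 y, Jk k y & pideal (T ^+ i) (x - y)) -> Jk k x.
Proof.
move=> xP; split.
  by have [y [Ty _] xy] := xP k; rewrite -(subrK y x); exact: idealD.
by apply: J_closed => i; have [y [_ Jy] xy] := xP i; exists y.
Qed.

(* The derivation t^(-h) (f \o D) corrects f: the new map is multiplicative
   up to products of two values of this derivation. *)
Lemma lifting_step m (f : alg_hom P S) :
    (r + h <= m)%N -> (c + h <= m)%N -> (2 * h <= m)%N ->
    (forall x, K x -> Jk m (f x)) ->
  exists2 g : alg_hom P S, forall x, K x -> Jk (2 * m - 2 * h) (g x) &
    forall x, Jk (m - h) (g x - f x).
Proof.
move=> rm cm hm fK; set M := (2 * m - 2 * h)%N.
(* [e] plays the role of [t^(-h) (f o D)]; the division is possible because [D x] lies in [K]. *)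
have /choice[e /all_and2[eJ eE]] x :
    exists e, Jk (m - h) e /\ f (D x) = T ^+ h * e.
  have [||e Je fe] := @Jk_div (m - h) (f (D x)); first by lia.
    by rewrite subnK; [exact: fK|lia].
  by exists e.
have fK2 x : K2 x -> Jk (2 * m) (f x).
  move: x; rewrite K2E; apply: (@gen_sub _ _ (preim_ideal f (Jk (2 * m)))).
  move=> _ [i [j [Ki Kj ->]]].
  rewrite /preim_ideal /= /preimage /= rmorphM mul2n -addnn.
  by apply: Jk_mul; exact: fK.
(* Transfers laws from [D] to [e]: [f w] lies in [Jk (2 * m)], hence is divisible by [T ^+ h] inside
   [J], and the torsion bound identifies the quotient with [z]. *)
have small z w : Jk (m - h) z -> T ^+ h * z = f w -> K2 w -> Jk M z.
  move=> Jz zw /fK2 Jw.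
  have [||z' Jz' fz'] := @Jk_div (2 * m - h) (f w); first by lia.
    by rewrite subnK //; lia.
  suff -> : z = z' by apply: Jk_le Jz'; lia.
  apply/subr0_eq/(torsion_exp torsion (k := h)); last first.
    by rewrite mulrBr zw fz' subrr.
  have rT k y : (r <= k)%N -> Jk k y -> pideal (T ^+ r) y.
    by move=> rk /(Jk_le rk)[].
  by apply: idealB; [apply: rT Jz|apply: rT Jz']; lia.
pose g x := f x - e x.
have TE x : T ^+ h * e x = f (D x) by rewrite eE.
have [||a|G GE] := @alg_hom_of A P (quot_alg (Jk M)) (quot_pi (Jk M) \o g).
- move=> x y /=; rewrite -rmorphB; apply/quot_piP.
  have : Jk M (e (x - y) - (e x - e y)).
    apply: small (DB x y); first by do ?apply: idealB.
    by rewrite !mulrBr !TE !rmorphB.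
  by move/idealN/ideal_eq; apply; rewrite /g rmorphB; ring.
- have e1 : Jk M (e 1).
    by apply: small (DA 1) => //; rewrite TE rmorph1.
  split=> [|x y] /=.
    rewrite -(rmorph1 (quot_pi (Jk M))); apply/quot_piP.
    by apply: (ideal_eq (idealN e1)); rewrite /g rmorph1; ring.
  rewrite -rmorphM; apply/quot_piP.
  have eM : Jk M (e (x * y) - (f x * e y + f y * e x)).
    apply: small (DM x y).
      apply: (idealB (eJ _)).
      by apply: idealD; apply: (@idealMl _ (Jk (m - h))); exact: eJ.
    rewrite rmorphB rmorphD !rmorphM -!TE; ring.
  (* The product of two corrections is the one error not controlled by [K2]; it has order
     [2 * (m - h) = M]. *)
  have ee : Jk M (e x * e y).
    by apply: Jk_le (Jk_mul (eJ x) (eJ y)); lia.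
  by apply: (ideal_eq (idealN (idealD eM ee))); rewrite /g rmorphM; ring.
- apply/quot_piP; rewrite /g hom_alg.
  have ea : Jk M (e (alg_map P a)) by apply: small (DA a) => //; rewrite TE.
  by apply: (ideal_eq (idealN ea)); ring.
(* [G] is lifted to [S] through its values on the [X i]. Since [Jk M] is closed, the quotient by it
   is separated, and [F] agrees with [G] there by uniqueness. *)
have [F FX] := X_hom (fun i => g (X i)) cS.
have FE x : Jk M (F x - g x).
  apply/quot_piP; rewrite -[RHS]GE.
  apply: (X_eq (f := comp_hom (quot_proj (Jk M)) F) (g := G)) => [|i].
    move=> y; elim/quot_piW: y => y yP; rewrite -(rmorph0 (quot_pi (Jk M))).
    apply/quot_piP; rewrite subr0; apply: Jk_closed => i.
    have [z] := yP i; elim/quot_piW: z => z yz.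
    have {yz}/quot_piP yz : quot_pi (Jk M) y = quot_pi (Jk M) (T ^+ i * z).
      by rewrite rmorphM rmorphXn.
    exists (y - T ^+ i * z) => //; exists z; ring.
  by rewrite GE /= FX.
exists F => x.
  move=> Kx; have fx := fK x Kx.
  have : Jk M (f x - e x).
    apply: (small _ (alg_map P (t ^+ h) * x - D x)).
    - by apply: idealB => //; apply: Jk_le fx; lia.
    - by rewrite mulrBr TE rmorphB rmorphM hom_alg rmorphXn.
    - by rewrite -opprB; apply: idealN; exact: DKE.
  by move=> gx; apply: (ideal_eq (idealD (FE x) gx)); rewrite /g subrK.
have Fx : Jk (m - h) (F x - g x) by apply: Jk_le (FE x); lia.
by apply: (ideal_eq (idealB Fx (eJ x))); rewrite /g; ring.
Qed.

Theorem lifting m (f : alg_hom P S) :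
    (r + h <= m)%N -> (c + h <= m)%N -> (2 * h < m)%N ->
    (forall x, K x -> Jk m (f x)) ->
  exists alpha : alg_hom B S, forall x, Jk (m - h) (alpha (p x) - f x).
Proof.
move=> rm cm hm fK.
(* [nx] performs one step on a pair of a map and its order; when the conditions fail, the map itself
   serves as dummy value. *)
have /choice[nx nxP] : forall q : alg_hom P S * nat, exists g : alg_hom P S,
    (m <= q.2)%N -> (forall x, K x -> Jk q.2 (q.1 x)) ->
    (forall x, K x -> Jk (2 * q.2 - 2 * h) (g x)) /\
    (forall x, Jk (q.2 - h) (g x - q.1 x)).
  move=> [g k] /=; have [mk|km] := leqP m k; last by exists g; lia.
  have [gK|ngK] := pselect (forall x, K x -> Jk k (g x)); last by exists g.
  have [|||g' g'K g'g] := @lifting_step k g _ _ _ gK; [lia|lia|lia|].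
  by exists g'.
pose q := fix q i :=
  if i is i'.+1 then (nx (q i'), 2 * (q i').2 - 2 * h)%N else (f, m).
pose F i := (q i).1.
(* As [2 * h < m], passing from order [k] to [2 * k - 2 * h] gains at least one. *)
have q_ge i : (m + i <= (q i).2)%N by elim: i => [|i IHi] /=; lia.
have FK i : forall x, K x -> Jk (q i).2 (F i x).
  by elim: i => [|i IHi] //; apply: (nxP (q i) _ IHi).1; have := q_ge i; lia.
have FS i x : Jk (m - h + i) (F i.+1 x - F i x).
  have [|_ /(_ x)] := nxP (q i) _ (FK i); first by have := q_ge i; lia.
  by apply: Jk_le; have := q_ge i; lia.
have Fm i x : Jk (m - h) (F i x - f x).
  elim: i => [|i IHi]; first by rewrite subrr; exact: ideal0.
  apply: (ideal_eq (idealD (Jk_le (leq_addr i _) (FS i x)) IHi)); ring.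
have /choice[G GP] x : exists y, forall i, pideal (T ^+ i) (y - F i x).
  have /choice[v vP] i : exists v, F i.+1 x - F i x = T ^+ i * v.
    by have [[v ->] _] := Jk_le (leq_addl (m - h) i) (FS i x); exists v.
  have [s sP] := cS.2 v; exists (f x + s) => i.
  apply: (ideal_eq (sP i)).
  rewrite (_ : F i x = f x + \sum_(j < i) T ^+ j * v j); first by ring.
  elim: i => [|i IHi]; first by rewrite big_ord0 addr0.
  by rewrite big_ord_recr /= -vP addrA -IHi; ring.
have GE x y : (forall i, pideal (T ^+ i) (F i x - y)) -> G x = y.
  move=> xy; apply/subr0_eq/cS.1 => i.
  by apply: (ideal_eq (idealD (GP x i) (xy i))); ring.
have [||a|H HE] := @alg_hom_of A P S G.
- move=> x y; apply: GE => i.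
  apply: (ideal_eq (idealB (GP y i) (GP x i))); rewrite rmorphB; ring.
- split=> [|x y]; apply: GE => i; first by rewrite rmorph1 subrr; exact: ideal0.
  have Gx := idealMr (G y) (GP x i); have Gy := idealMl (F i x) (GP y i).
  by apply: (ideal_eq (idealN (idealD Gx Gy))); rewrite rmorphM; ring.
- by apply: GE => i; rewrite hom_alg subrr; exact: ideal0.
(* The limit kills [K] because the orders of the [F i x] tend to infinity, so it factors through
   [p]. *)
have [|alpha alphaE] := alg_hom_factor (p := p) (f := H) pS.
  move=> x /Kp Kx; rewrite HE; apply: GE => i; rewrite subr0.
  have [] // := Jk_le (i := i) (j := (q i).2) _ (FK i x Kx).
  by have := q_ge i; lia.
exists alpha => x; rewrite alphaE HE; apply: Jk_closed => i.
exists (F i x - f x) => //; apply: (ideal_eq (GP x i)); ring.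
Qed.

End Lifting.

(** * Completeness of quotients, reductions and presentations *)

Lemma complete_at_unit (R : comPzRingType) (t u : R) :
  complete_at t -> exists v, v * (1 - u * t) = 1.
Proof.
move=> [sepR sumR]; have [s sP] := sumR (fun i => u ^+ i); exists s.
apply/subr0_eq/sepR => k.
have geom : (\sum_(i < k) t ^+ i * u ^+ i) * (1 - u * t) = 1 - t ^+ k * u ^+ k.
  elim: k => [|k IHk]; first by rewrite big_ord0; ring.
  by rewrite big_ord_recr mulrDl IHk /= !exprS; ring.
have tu : pideal (t ^+ k) (t ^+ k * u ^+ k) by exists (u ^+ k).
apply: (ideal_eq (idealB (idealMr (1 - u * t) (sP k)) tu)).
by rewrite mulrBl geom; ring.
Qed.

(* Separatedness is Krull's intersection theorem, t lying in the Jacobson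
   radical: if x = t^k w_k with w_k = t w_(k+1), the chain of ideals (w_k) is
   stationary, so w_(N+1) = u w_N = u t w_(N+1) vanishes. *)
Lemma complete_at_surj (R S : comPzRingType) (f : {rmorphism R -> S})
    (t : R) r :
    surjective f -> seq_noetherian S -> complete_at t ->
    (forall x, pideal (f t ^+ r) x -> f t * x = 0 -> x = 0) ->
  complete_at (f t).
Proof.
move=> fS nS cR torsion; split; last first.
  move=> v; have /choice[u uv] i := fS (v i); have [s sP] := cR.2 u.
  exists (f s) => k; have := pideal_rmorph f (sP k).
  rewrite rmorphXn => /ideal_eq; apply; rewrite rmorphB rmorph_sum.
  by congr (_ - _); apply: eq_bigr => i _; rewrite rmorphM rmorphXn uv.
move=> x xP.
have /choice[z zP] k : exists z, x = f t ^+ k * z by exact: xP.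
(* The factor [f t ^+ r] places [w k] where torsion vanishes, so that powers of [f t] can be
   cancelled. *)
pose w k := f t ^+ r * z (r + k)%N.
have xw k : x = f t ^+ k * w k by rewrite /w mulrA -exprD addnC -zP.
have rw k : pideal (f t ^+ r) (w k) by exists (z (r + k)%N).
have wS k : w k = f t * w k.+1.
  apply/subr0_eq/(torsion_exp torsion (k := k)).
    by apply: (idealB (rw k)); apply: idealMl; exact: rw.
  by rewrite mulrBr (mulrA _ (f t)) -exprSr -!xw subrr.
have [k y [v ->]|N wN] := seq_noetherian_acc (L := fun k => pideal (w k)) nS.
  by exists (f t * v); rewrite (wS k); ring.
have [|u wu] := wN N.+1 (w N.+1); first by exists 1; rewrite mulr1.
have [u' u'u] := fS u; have [v v1] := complete_at_unit u' cR.
have w0 : (1 - u * f t) * w N.+1 = 0.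
  by rewrite mulrBl mul1r {1}wu wS; ring.
by rewrite (xw N.+1) -[w _]mul1r -(rmorph1 f) -v1 rmorphM rmorphB rmorph1
  rmorphM u'u -mulrA w0 !mulr0.
Qed.

Section Reduction.
Variables (A : comPzRingType) (a : ideal A) (t : A) (C : alg A).
Hypothesis at_ : a = pideal t :> set A.

Lemma red_projP k x y :
  red_proj C a k x = red_proj C a k y <-> pideal (alg_map C t ^+ k) (x - y).
Proof.
rewrite [_ = _]quot_piP /ideal_mem.
by rewrite (ideal_ext_exp_pideal C k at_).
Qed.

Lemma red_projS k : surjective (red_proj C a k).
Proof. by move=> y; exists (repr y); exact: quot_reprK. Qed.

Lemma red_separated k : separated_at (alg_map (red C a k) t).
Proof.
move=> x /(_ k) [y ->]; rewrite -(rmorphXn (alg_map _)).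
rewrite (_ : alg_map _ _ = 0) ?mul0r // -(rmorph0 (red_proj C a k)).
apply/red_projP; rewrite subr0 rmorphXn; exists 1; by rewrite mulr1.
Qed.

End Reduction.

Lemma formally_fg_presentation (A : comPzRingType) (a : ideal A) (B : alg A) :
  formally_fg a B ->
  exists m (p : alg_hom (restricted_alg a m) B) (K : ideal _),
    surjective p /\ forall x, K x <-> p x = 0.
Proof.
move=> [m [K [f [g fK gK]]]].
exists m, (comp_hom f (quot_proj K)), K; split=> [b|x].
  exists (repr (g b)); rewrite /= -[RHS]gK; congr (f _); exact: quot_reprK.
rewrite /=; split=> [Kx|].
  rewrite -(rmorph0 f); congr (f _); rewrite -(rmorph0 (quot_pi K)).
  by apply/quot_piP; rewrite subr0.
rewrite -(rmorph0 f) => /(can_inj fK); rewrite -(rmorph0 (quot_pi K)).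
by move=> /quot_piP; rewrite subr0.
Qed.

(** Packages a presentation of [B] with its lifting property; [K] and [D] stay internal and only the
    kernel of [p] is visible. *)
Lemma formally_fg_lifting (A : comPzRingType) (a : ideal A) (t : A)
    (B : alg A) h :
    seq_noetherian A -> a = pideal t :> set A -> formally_fg a B ->
    Hbar B (alg_map B (t ^+ h)) ->
  exists (P : alg A) (p : alg_hom P B) m (X : 'I_m -> P),
  [/\ surjective p,
      forall (C : alg A) (c : 'I_m -> C), complete_at (alg_map C t) ->
        exists g : alg_hom P C, forall i, g (X i) = c i,
      forall (C : alg A) (f g : alg_hom P C), separated_at (alg_map C t) ->
        (forall i, f (X i) = g (X i)) -> f =1 g &
      forall (S : alg A) (J : ideal S) r c,
        let T := alg_map S t in
        let Jk k : ideal S := ideal_cap (pideal (T ^+ k)) J in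
        complete_at T ->
        (forall x,
           (forall k, exists2 y, J y & pideal (T ^+ k) (x - y)) -> J x) ->
        (forall k x, (c <= k)%N -> Jk k x ->
           exists2 y, Jk c y & x = T ^+ (k - c) * y) ->
        (forall x, pideal (T ^+ r) x -> T * x = 0 -> x = 0) ->
        forall k (f : alg_hom P S),
        (r + h <= k)%N -> (c + h <= k)%N -> (2 * h < k)%N ->
        (forall x, p x = 0 -> Jk k (f x)) ->
      exists alpha : alg_hom B S, forall x, Jk (k - h)%N (alpha (p x) - f x)].
Proof.
move=> nA at_ /formally_fg_presentation[m [p [K [pS Kp]]]] He.
have [X [X_hom X_eq /(_ nA) nP]] := restricted_alg_spec m at_.
exists (restricted_alg a m), p, m, X; split=> //.
move=> S J r c T Jk cS J_closed J_AR torsion k f rk ck hk fK.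
have [s Ks] := nP K.
have [D [DK DB DM DA DKE]] := Hbar_derivation pS Kp Ks He.
apply: (lifting pS X_hom X_eq cS J_closed J_AR torsion Kp erefl
  DK DB DM DA DKE) => //.
by move=> x /Kp; exact: fK.
Qed.

(** * Compatible lifts of [alpha_n] and [beta_n] *)

Theorem theorem26
  (A : comPzRingType) (t : A) (a : ideal A) (B B' C C' : alg A)
  (pi : alg_hom B B') (I : ideal C) (phi : alg_hom C C') (r h c n : nat)
  (noethA : noetherian A) (noethB : noetherian B) (noethB' : noetherian B')
  (noethC : noetherian C) (noethC' : noetherian C')
  (a_principal : a = ideal_gen [set t])
  (A_complete : adic_complete a)
  (B_ffg : formally_fg a B) (B'_ffg : formally_fg a B')
  (pi_surj : surjective pi)
  (I_ker : forall x, I x <-> phi x = 0) (phi_surj : surjective phi)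
  (C_complete : adic_complete (ideal_ext C a))
  (torsC : ideal_ext C (ideal_exp a r) `&` ann (alg_map C t) = [set 0])
  (torsC' : ideal_ext C' (ideal_exp a r) `&` ann (alg_map C' t) = [set 0])
  (artin_rees : forall k, (c <= k)%N ->
     ideal_cap (ideal_ext C (ideal_exp a k)) I =
     ideal_mul (ideal_ext C (ideal_exp a (k - c)))
       (ideal_cap (ideal_ext C (ideal_exp a c)) I) :> set C)
  (HB : ideal_ext B (ideal_exp a h) `<=` Hbar B)
  (HB' : ideal_ext B' (ideal_exp a h) `<=` Hbar B')
  (n_gt : (maxn (r + 2 * h) (maxn (c + 2 * h) (4 * h)) < n)%N)
  (alpha_n : alg_hom B (red C a n)) (beta_n : alg_hom B' (red C' a n))
  (compat_n : forall b, red_hom phi a n (alpha_n b) = beta_n (pi b)) :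
  exists (alpha : alg_hom B C) (beta : alg_hom B' C'),
    [/\ forall b, phi (alpha b) = beta (pi b),
        forall b, red_proj C a (n - 2 * h) (alpha b) =
                  red_le C a (leq_subr (2 * h) n) (alpha_n b) &
        forall b', red_proj C' a (n - 2 * h) (beta b') =
                   red_le C' a (leq_subr (2 * h) n) (beta_n b')].
Proof.
have at_ : a = pideal t :> set A by rewrite a_principal ideal_gen1.
have nA := noetherian_seq noethA.
pose T := alg_map C t; pose T' := alg_map C' t.
have TT' : phi T = T' by exact: hom_alg.
have tors (S : alg A) :
    ideal_ext S (ideal_exp a r) `&` ann (alg_map S t) = [set 0] ->
    forall x, pideal (alg_map S t ^+ r) x -> alg_map S t * x = 0 -> x = 0.
  move=> torsS x Tx tx; change ([set 0 : S] x); rewrite -torsS; split => //.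
  by rewrite (ideal_ext_exp_pideal S r at_).
have tC := tors C torsC; have tC' := tors C' torsC'.
have cC : complete_at T.
  exact: adic_complete_at (ideal_ext_pideal C at_) C_complete.
have cC' : complete_at T'.
  rewrite -TT'; apply: (complete_at_surj (r := r) phi_surj) => //.
    exact: noetherian_seq.
  by rewrite TT'.
have Hb (D : alg A) : ideal_ext D (ideal_exp a h) `<=` Hbar D ->
    Hbar D (alg_map D (t ^+ h)).
  apply; rewrite (ideal_ext_exp_pideal D h at_) rmorphXn.
  by exists 1; rewrite mulr1.
have red_leE (D : alg A) i j (ij : (i <= j)%N) (x : D) :
    red_le D a ij (red_proj D a j x) = red_proj D a i x.
  exact: quot_homE.
have [P' [p' [m' [X' [p'S X'_hom X'_eq lift']]]]] :=
  formally_fg_lifting nA at_ B'_ffg (Hb _ HB').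
have /choice[c' c'P] i := red_projS (beta_n (p' (X' i))).
have [f0 f0X] := X'_hom C' c' cC'.
have f0E : comp_hom (red_proj C' a n) f0 =1 comp_hom beta_n p'.
  by apply: X'_eq => [|i]; [exact: (red_separated at_)|rewrite /= f0X c'P].
(* With the full ideal as [J], the Artin-Rees condition holds with constant 0. *)
have [||||||beta betaE] := lift' C' (ideal_full C') r 0%N cC' _ _ tC' n f0.
- by [].
- move=> k x _ [[y ->] _]; exists y; last by rewrite subn0.
  by split=> //; exists y; rewrite mul1r.
- by lia.
- by lia.
- by lia.
- move=> x px; split=> //; rewrite -(subr0 (f0 x)).
  by apply/(red_projP at_); rewrite [LHS]f0E /= px !rmorph0.
have beta_red z b' : red_proj C' a n z = beta_n b' ->
    pideal (T' ^+ (n - h)) (beta b' - z).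
  have [x <-] := p'S b'; rewrite -[RHS]f0E => /esym/(red_projP at_) fz.
  have [bf _] := betaE x.
  apply: (ideal_eq (idealD bf (pideal_exp_le (leq_subr h n) fz))); ring.
have [P [p [m [X [pS X_hom X_eq lift]]]]] :=
  formally_fg_lifting nA at_ B_ffg (Hb _ HB).
(* A lift [c0] of [alpha_n (p (X i))] has the right image in [C'] only modulo [T' ^+ (n - h)];
   adding a multiple of [T ^+ (n - h)] makes that image exact. *)
have /choice[c1 c1P] i : exists c1, phi c1 = beta (pi (p (X i))) /\
    red_proj C a (n - h) c1 = red_le C a (leq_subr h n) (alpha_n (p (X i))).
  have [c0 c0E] := red_projS (alpha_n (p (X i))).
  have [|w bw] := beta_red (phi c0) (pi (p (X i))).
    by rewrite -compat_n -c0E; exact/esym/quot_homE.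
  have [z zw] := phi_surj w; exists (c0 + T ^+ (n - h) * z); split.
    by rewrite rmorphD rmorphM rmorphXn TT' zw -bw addrC subrK.
  rewrite -c0E red_leE; apply/(red_projP at_); exists z.
  by rewrite addrAC subrr add0r.
have [f fX] := X_hom C c1 cC.
have phif : comp_hom phi f =1 comp_hom beta (comp_hom pi p).
  apply: X_eq => [|i]; first exact: cC'.1.
  by rewrite /= fX (c1P i).1.
have redf : comp_hom (red_proj C a (n - h)) f =1
    comp_hom (red_le C a (leq_subr h n)) (comp_hom alpha_n p).
  apply: X_eq => [|i]; first exact: (red_separated at_).
  by rewrite [LHS]/= fX (c1P i).2.
(* The start order is [n - h], because [f] agrees with [alpha_n] only to that order; the lifting
   loses another [h]. Taking [J = I] keeps the image under [phi] unchanged. *)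
have [||||||alpha alphaE] := lift C I r c cC _ _ tC (n - h)%N f.
- move=> x xP; apply/I_ker/cC'.1 => k; have [y /I_ker phiy xy] := xP k.
  have := pideal_rmorph phi xy; rewrite rmorphB phiy subr0 rmorphXn.
  by rewrite -/T TT'.
- move=> k x ck [Tx Ix].
  have : ideal_cap (ideal_ext C (ideal_exp a k)) I x.
    by split=> //; rewrite (ideal_ext_exp_pideal C k at_).
  rewrite /ideal_mem artin_rees //.
  (* The first factor of the product is principal, so a sum of products collapses to a single
     multiple of [T ^+ (k - c)]. *)
  pose L : set C := [set x | exists2 y,
    ideal_cap (pideal (T ^+ c)) I y & x = T ^+ (k - c) * y].
  have L0 : L 0 by exists 0; [exact: ideal0|rewrite mulr0].
  have LD u v : L u -> L v -> L (u + v).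
    move=> [y Jy ->] [z Jz ->]; exists (y + z); last by rewrite mulrDr.
    exact: idealD.
  have LM s u : L u -> L (s * u).
    by move=> [y Jy ->]; exists (s * y); [exact: idealMl|rewrite mulrCA].
  apply: (@gen_sub _ _ (Ideal L0 LD LM)) => _ [i [j [+ [+ Ij] ->]]].
  rewrite /ideal_mem !(ideal_ext_exp_pideal C _ at_) => -[y ->] Tj.
  exists (y * j); last by rewrite mulrA.
  by apply: idealMl; split.
- by lia.
- by lia.
- by lia.
- move=> x px; split; last first.
    by apply/I_ker; have := phif x; rewrite /= px !rmorph0.
  rewrite -(subr0 (f x)); apply/(red_projP at_).
  rewrite [LHS]redf -[LHS]/(red_le C a (leq_subr h n) (alpha_n (p x))) px.
  by rewrite !rmorph0.
exists alpha, beta; split=> [b|b|b'].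
- have [x <-] := pS b; have [_ /I_ker] := alphaE x.
  by rewrite rmorphB => /subr0_eq ->; exact: phif.
- have [x <-] := pS b; have [z zE] := red_projS (alpha_n (p x)).
  have : red_proj C a (n - h) (f x) = red_proj C a (n - h) z.
    rewrite [LHS]redf -(red_leE C _ _ (leq_subr h n)) zE //.
  move=> /(red_projP at_) fz; rewrite -zE red_leE; apply/(red_projP at_).
  have [af _] := alphaE x; rewrite mul2n -addnn subnDA.
  apply: (ideal_eq (idealD af (pideal_exp_le (leq_subr h (n - h)) fz))); ring.
- have [z zE] := red_projS (beta_n b').
  rewrite -zE red_leE; apply/(red_projP at_).
  by apply: pideal_exp_le (beta_red _ _ zE); lia.
Qed.
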